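(* Let $1<\alpha<2$ and $n\ge1$. Let $\tau$ be a Young function satisfying $\tau(y)=y^2\psi(y)$ for some positive and non-decreasing function $\psi$ going to $+\infty$ at infinity, and such that there exists a constant $k(\psi)$ with $\psi(2y)\le k(\psi)\psi(y)$. A sufficient condition for $(\mathbf P_t^\alpha)_{t\ge0}$ to be $\tau$-Orlicz hyperbounded is that $\mathbf P_t^\alpha(e^{U_\alpha})\in L_\tau(\nu_\alpha)$ for some $t>0$.
   Context: Let $u_\alpha:\mathbb R\to\mathbb R$ be the $C^2$ convex function $u_\alpha(x)=|x|^\alpha$ for $|x|>1$ and $u_\alpha(x)=\frac{\alpha(\alpha-2)}{8}x^4+\frac{\alpha(4-\alpha)}{4}x^2+\left(1-\frac34\alpha+\frac18\alpha^2\right)$ for $|x|\le1$. On $\mathbb R^n$ put $U_\alpha(x)=\sum_{i=1}^nu_\alpha(x_i)$ and $\nu_\alpha(dx)=Z_\alpha^{-1}e^{-2U_\alpha(x)}dx$, a probability measure ($Z_\alpha$ is the normalizing constant). $(\mathbf P_t^\alpha)_{t\ge0}$ is the $\nu_\alpha$-symmetric semigroup generated by $A_\alpha=\frac12\Delta-\nabla U_\alpha\cdot\nabla$; it is given (also for non-negative measurable $h$) by $$(\mathbf P_t^\alpha h)(x)=e^{U_\alpha(x)}\,\mathbb E^{\mathbb P_x}\left[h(X_t)e^{-U_\alpha(X_t)}M_t\right],\qquad M_t=\exp\left(\frac12\int_0^t\big(\Delta U_\alpha-|\nabla U_\alpha|^2\big)(X_s)\,ds\right),$$ where under $\mathbb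 P_x$, $X$ is an $n$-dimensional Brownian motion started at $x$. A Young function is a continuous, even, convex function vanishing at $0$; as throughout the paper, $\tau$ is also assumed to satisfy $\tau(y)/y^2\to+\infty$ and $\tau(y)/y^p\to0$ for every $p>2$ as $y\to+\infty$. $L_\tau(\nu_\alpha)$ is the set of measurable $f$ with $\int\tau(f)\,d\nu_\alpha<\infty$, with gauge norm $N_\tau(f)=\inf\{k>0:\ \int\tau(f/k)\,d\nu_\alpha\le\tau(1)\}$. A $\mu$-symmetric semigroup $(\mathbf P_t)$ is called $\tau$-Orlicz hyperbounded if for some $s>0$, $\mathbf P_s$ is a continuous mapping from $L^2(\mu)$ into $L_\tau(\mu)$. *)

(* Defs.v *)
From HB Require Import structures.
From mathcomp Require Import all_boot all_order all_algebra.
From mathcomp Require Import all_classical all_reals all_analysis.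
From mathcomp Require Import measurable_realfun.

Set Implicit Arguments.
Unset Strict Implicit.
Unset Printing Implicit Defensive.

Import Order.TTheory GRing.Theory Num.Theory.
Import numFieldNormedType.Exports.

Local Open Scope classical_set_scope.
Local Open Scope ring_scope.

Notation Rn R n := (n.-tuple (measurableTypeR R)).

Section lebesgue_Rn.
Context {R : realType}.

Definition consRn n (p : measurableTypeR R * Rn R n) : Rn R n.+1 :=
  [the n.+1.-tuple _ of p.1 :: p.2].

Lemma measurable_consRn n : measurable_fun setT (@consRn n).
Proof. exact: measurable_cons. Qed.

Section step.
Variables (n : nat) (m : {sigma_finite_measure set (Rn R n) -> \bar R}).

Definition lebesgueRn_step : set (Rn R n.+1) -> \bar R :=
  pushforward (lebesgue_measure \x m)%E (@consRn n).

Let lebesgueRn_step0 : lebesgueRn_step set0 = 0%E.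
Proof. by rewrite /lebesgueRn_step /pushforward preimage_set0 measure0. Qed.

Let lebesgueRn_step_ge0 A : (0 <= lebesgueRn_step A)%E.
Proof. by rewrite /lebesgueRn_step /pushforward; exact: measure_ge0. Qed.

Let lebesgueRn_step_sigma_additive : semi_sigma_additive lebesgueRn_step.
Proof.
have mpre (B : set (Rn R n.+1)) : measurable B -> measurable (@consRn n @^-1` B).
  by move=> mB; rewrite -[X in measurable X]setTI; exact: measurable_consRn.
move=> F mF tF mUF; rewrite /lebesgueRn_step /pushforward preimage_bigcup.
apply: measure_semi_sigma_additive.
- by move=> i; exact: mpre.
- apply/trivIsetP => /= i j _ _ ij; rewrite -preimage_setI.
  by move/trivIsetP : tF => /(_ _ _ _ _ ij) ->//; rewrite preimage_set0.
- by rewrite -preimage_bigcup; exact: mpre.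
Qed.

HB.instance Definition _ := isMeasure.Build _ _ _ lebesgueRn_step
  lebesgueRn_step0 lebesgueRn_step_ge0 lebesgueRn_step_sigma_additive.

Let lebesgueRn_step_sigma_finite : sigma_finite setT lebesgueRn_step.
Proof.
have /sigma_finiteP[F [TF ndF Foo]] := sigma_finiteT (@lebesgue_measure R).
have /sigma_finiteP[G [TG ndG Goo]] := sigma_finiteT m.
pose g (t : Rn R n.+1) : measurableTypeR R * Rn R n :=
  (thead t, [tuple of behead t]).
have mg : measurable_fun setT g.
  apply: measurable_fun_pair; first exact: measurable_tnth.
  exact: measurable_behead.
have gK p : g (consRn p) = p by case: p => x v; congr pair; apply/val_inj.
exists (fun i => g @^-1` (F i `*` G i)) => [|i].
  apply/esym; rewrite -subTset => t _.
  have [i _ Fi] : (\bigcup_i F i) (g t).1 by rewrite -TF.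
  have [j _ Gj] : (\bigcup_i G i) (g t).2 by rewrite -TG.
  exists (maxn i j) => //; split.
  - by move: (g t).1 Fi; exact/subsetPset/ndF/leq_maxl.
  - by move: (g t).2 Gj; exact/subsetPset/ndG/leq_maxr.
have [[mF Fi] [mG Gi]] := (Foo i, Goo i); split.
  by rewrite -[X in measurable X]setTI; apply: mg => //; exact: measurableX.
rewrite /lebesgueRn_step /pushforward -comp_preimage.
rewrite (_ : g \o _ = id); last by apply/funext => p /=; exact: gK.
by rewrite preimage_id product_measure1E// lte_mul_pinfty// ge0_fin_numE.
Qed.

HB.instance Definition _ := Measure_isSigmaFinite.Build _ _ _ lebesgueRn_step
  lebesgueRn_step_sigma_finite.

End step.

Fixpoint lebesgueRn n : {sigma_finite_measure set (Rn R n) -> \bar R} :=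
  match n with
  | 0%N => dirac [tuple]
  | n'.+1 => lebesgueRn_step (lebesgueRn n')
  end.

End lebesgue_Rn.

Section differential_operators.
Context {R : realType} {n : nat}.
Implicit Types (f : Rn R n -> R) (x : Rn R n) (i : 'I_n).

Definition set_coord i x (s : R) : Rn R n :=
  [tuple (if j == i then s else tnth x j) | j < n].

Definition partial i f x : R :=
  derive1 (fun s : R => f (set_coord i x s)) (tnth x i).

Definition grad_normsq f x : R := \sum_(i < n) (partial i f x) ^+ 2.

Definition laplacian f x : R := \sum_(i < n) partial i (partial i f) x.

End differential_operators.

Section potential.
Context {R : realType}.

Definition u_alpha (alpha x : R) : R :=
  if 1 < `|x| then `|x| `^ alpha
  else alpha * (alpha - 2) / 8 * x ^+ 4 + alpha * (4 - alpha) / 4 * x ^+ 2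
       + (1 - 3 / 4 * alpha + 1 / 8 * alpha ^+ 2).

Definition U_alpha (n : nat) (alpha : R) (x : Rn R n) : R :=
  \sum_(i < n) u_alpha alpha (tnth x i).

Lemma measurable_u_alpha alpha :
  measurable_fun [set: measurableTypeR R] (u_alpha alpha).
Proof.
have mnorm : measurable_fun [set: measurableTypeR R] (fun x : R => `|x|).
  exact: measurableT_comp.
apply: measurable_fun_ifT => /=.
- by apply: measurable_fun_ltr; first exact: measurable_cst.
- exact: (measurableT_comp (measurable_powR alpha) mnorm).
- apply: measurable_funD; last exact: measurable_cst.
  by apply: measurable_funD; apply: measurable_funM;
    [exact: measurable_cst|exact: measurable_funX|
     exact: measurable_cst|exact: measurable_funX].
Qed.

Lemma measurable_U_alpha n alpha : measurable_fun setT (@U_alpha n alpha).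
Proof.
apply: measurable_sum => i; apply: (measurableT_comp (measurable_u_alpha _)).
exact: measurable_tnth.
Qed.

End potential.
Arguments U_alpha {R} n alpha x.

Section nu_alpha.
Context {R : realType} (n : nat) (alpha : R).

Definition Z_alpha : R :=
  (\int[@lebesgueRn R n]_x expR (- 2 * U_alpha n alpha x))%R.

Definition nu_alpha (A : set (Rn R n)) : \bar R :=
  (\int[lebesgueRn n]_(x in A) (Z_alpha^-1 * expR (- 2 * U_alpha n alpha x))%:E)%E.

Let density_ge0 x : 0 <= Z_alpha^-1 * expR (- 2 * U_alpha n alpha x).
Proof.
rewrite mulr_ge0 ?expR_ge0// invr_ge0 fine_ge0//; apply: integral_ge0 => y _.
by rewrite lee_fin expR_ge0.
Qed.

Let nu_alpha0 : nu_alpha set0 = 0%E.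
Proof. by rewrite /nu_alpha integral_set0. Qed.

Let nu_alpha_ge0 A : (0 <= nu_alpha A)%E.
Proof. by apply: integral_ge0 => x _; rewrite lee_fin. Qed.

Let nu_alpha_sigma_additive : semi_sigma_additive nu_alpha.
Proof.
move=> /= F mF tF mUF; rewrite /nu_alpha; apply: cvg_toP.
  apply: ereal_nondecreasing_is_cvgn => k m km.
  apply: lee_sum_nneg_natr => // j _ _; exact: nu_alpha_ge0.
rewrite ge0_integral_bigcup//=.
- apply/measurable_funTS/measurable_EFinP; apply: measurable_funM => //.
  apply: measurableT_comp => //; apply: measurable_funM => //.
  exact: measurable_U_alpha.
- by move=> x _; rewrite lee_fin.
Qed.

HB.instance Definition _ := isMeasure.Build _ _ _ nu_alpha
  nu_alpha0 nu_alpha_ge0 nu_alpha_sigma_additive.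

End nu_alpha.
Arguments nu_alpha {R} n alpha A.

Section brownian_motion.
Context {R : realType} {n : nat} {d : measure_display} {Omega : measurableType d}.

Definition incr (X : R -> Omega -> Rn R n) (s t : R) (w : Omega) : Rn R n :=
  [tuple tnth (X t w) i - tnth (X s w) i | i < n].

Definition past (X : R -> Omega -> Rn R n) (s : R) : set (set Omega) :=
  <<s [set E | exists (r : R) (B : set (Rn R n)),
         [/\ 0 <= r, r <= s, measurable B & E = X r @^-1` B] ] >>.

(* Under P, X is an n-dimensional Brownian motion started at x. The process is
   indexed by R but only its restriction to [0, +oo[ is constrained. The
   increment on [s, t] is N(0, (t - s) I_n), i.e. its coordinates are
   independent and N(0, t - s); the second parameter of normal_prob is a
   standard deviation. *)
Record brownian_motion (P : probability Omega R) (X : R -> Omega -> Rn R n)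
    (x : Rn R n) : Prop := {
  bm_measurable : forall t : R, 0 <= t -> measurable_fun setT (X t) ;
  bm_continuous : forall w (i : 'I_n),
    {within `[0, +oo[, continuous (fun t : R => tnth (X t w) i : R)} ;
  bm_start : P (X 0 @^-1` [set x]) = 1%E ;
  bm_gaussian : forall s t : R, 0 <= s -> s < t ->
    forall A : 'I_n -> set (measurableTypeR R), (forall i, measurable (A i)) ->
    P [set w | forall i, A i (tnth (incr X s t w) i)] =
      (\prod_(i < n) normal_prob 0 (Num.sqrt (t - s)) (A i))%E ;
  bm_independent : forall s t : R, 0 <= s -> s < t ->
    forall (E : set Omega) (B : set (Rn R n)), past X s E -> measurable B ->
    P (E `&` incr X s t @^-1` B) = (P E * P (incr X s t @^-1` B))%E
}.

End brownian_motion.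

Section semigroup.
Context {R : realType} {n : nat} {d : measure_display} {Omega : measurableType d}.
Variables (alpha : R) (P : Rn R n -> probability Omega R).
Variable X : R -> Omega -> Rn R n.

Local Notation U := (U_alpha n alpha).

Definition M_alpha (t : R) (w : Omega) : R :=
  expR (2^-1 * \int[lebesgue_measure]_(s in `[0, t])
                  (laplacian U (X s w) - grad_normsq U (X s w))).

(* Feynman-Kac form of the nu_alpha-symmetric semigroup generated by
   Delta/2 - grad U . grad. The value is an extended real, so finiteness of the
   expectation is not presupposed; an undefined expectation (+oo - oo) is -oo,
   which tau_ext below sends to +oo. *)
Definition P_alpha (t : R) (h : Rn R n -> R) (x : Rn R n) : \bar R :=
  ((expR (U x))%:E *
   'E_(P x)[(fun w => h (X t w) * expR (- U (X t w)) * M_alpha t w)%R])%E.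

End semigroup.

Section orlicz.
Context {R : realType} {d : measure_display} {T : measurableType d}.
Variables (mu : {measure set T -> \bar R}) (tau : R -> R).

Definition young_function : Prop :=
  [/\ continuous tau, forall y, tau (- y) = tau y,
      convex_function [set: R^o] tau & tau 0 = 0].

(* tau extended by tau(-oo) = tau(+oo) = +oo, so that the elements of the
   Orlicz space are finite almost everywhere. *)
Definition tau_ext (y : \bar R) : \bar R :=
  if y is r%:E then (tau r)%:E else +oo%E.

Definition in_orlicz (f : T -> \bar R) : Prop :=
  measurable_fun setT f /\ (\int[mu]_x tau_ext (f x) < +oo)%E.

Definition gauge_norm (f : T -> \bar R) : \bar R :=
  ereal_inf [set k%:E | k in [set k : R | 0 < k /\
    (\int[mu]_x tau_ext ((k^-1)%:E * f x) <= (tau 1)%:E)%E]].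

Definition orlicz_hyperbounded (S : R -> (T -> R) -> T -> \bar R) : Prop :=
  exists s : R, 0 < s /\
    (forall h, h \in Lfun mu 2%:E -> in_orlicz (S s h)) /\
    (forall h, h \in Lfun mu 2%:E -> forall eps : R, 0 < eps ->
      exists delta : R, 0 < delta /\
        forall g, g \in Lfun mu 2%:E ->
          ('N[mu]_(2%:E)[EFin \o (g \- h)%R] < delta%:E)%E ->
          (gauge_norm (fun x => S s g x - S s h x) < eps%:E)%E).

End orlicz.

(* Main.v *)
Require Import Defs.
From HB Require Import structures.
From mathcomp Require Import all_boot all_order all_algebra.
From mathcomp Require Import all_classical all_reals all_analysis.
From mathcomp Require Import measurable_realfun.
From mathcomp Require Import ring lra.

Set Implicit Arguments.
Unset Strict Implicit.
Unset Printing Implicit Defensive.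

Import Order.TTheory GRing.Theory Num.Theory.
Import numFieldNormedType.Exports.

Local Open Scope classical_set_scope.
Local Open Scope ring_scope.

(** The semigroup is a Feynman-Kac semigroup seen through the ground state:
    P_t h = e^U E_x[f(X_t) M_t] with f = h e^(-U) and
    M_t = exp(1/2 int_0^t V(X_s) ds), V = Delta U - |grad U|^2. The factor
    e^(-U) is chosen so that int f^2 dx = Z int h^2 dnu.

    For 1 < alpha < 2 each coordinate contributes u'' - u'^2 <= u'' <= 4 to V,
    so V is bounded above and M_(2t) <= e^(c t) M_t (fk_weightD): once the
    weight has been paid up to time t, the remaining time costs a constant.
    What is left, E_x[f(X_(2t)) M_t], is computed by conditioning at time t
    (markov): X_(2t) is X_t plus an independent Gaussian vector whose density
    is bounded by a constant, so the conditional mean of f(X_(2t)) is at most a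
    multiple of the norm of f in L^2(dx), wherever X_t is (heat_le_L2). Hence
    E_x[|f|(X_(2t)) M_t] <= K |h|_2 E_x[M_t], and multiplying by e^U gives the
    pointwise bound
      |P_(2t) h| <= K |h|_2 P_t(e^U)
    (fk_expect_le, P_alpha_dominated). Domination by a single function of the
    Orlicz class, linear in the norm of h, yields a bounded, hence continuous,
    map into that class: the doubling of psi gives
    tau(a y) <= c(a) tau(y), and tau(y / k) <= tau(y) / k makes the gauge norm
    of the dominating function finite (hyperbounded_of_domination).

    The other half of the work is the measurability of x |-> P_(2t) h(x). The
    measures P_x are an arbitrary family in which each P_x makes X a Brownian
    motion started at x, so it has to come from the uniqueness of the law. The
    path t |-> V(X_t) is continuous, hence M_t is a limit of exponentials of
    Riemann sums (cvg_fk_weight); the corresponding expectations only involve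
    finitely many times and are, by iterating the Markov property, iterates at
    x of one explicit kernel (expect_chain). The same approximation shows that
    M_t only depends on the path up to time t, which the conditioning at time
    t requires. *)

(** * Measures with a density *)

Section density.
Context {d : measure_display} {T : measurableType d} {R : realType}.
Variables (mu : {measure set T -> \bar R}) (f : T -> R).

Definition with_density (mf : measurable_fun setT f) (f0 : forall x, 0 <= f x)
  (A : set T) : \bar R := (\int[mu]_(x in A) (f x)%:E)%E.

Variables (mf : measurable_fun setT f) (f0 : forall x, 0 <= f x).

Let with_density0 : with_density mf f0 set0 = 0%E.
Proof. exact: integral_set0. Qed.

Let with_density_ge0 A : (0 <= with_density mf f0 A)%E.
Proof. by apply: integral_ge0 => x _; rewrite lee_fin. Qed.

Let with_density_sigma_additive : semi_sigma_additive (with_density mf f0).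
Proof.
move=> /= F mF tF mUF; rewrite /with_density; apply: cvg_toP.
  apply: ereal_nondecreasing_is_cvgn => k m km.
  by apply: lee_sum_nneg_natr => // j _ _; exact: with_density_ge0.
rewrite ge0_integral_bigcup//=.
- exact/measurable_funTS/measurable_EFinP.
- by move=> x _; rewrite lee_fin.
Qed.

HB.instance Definition _ := isMeasure.Build _ _ _ (with_density mf f0)
  with_density0 with_density_ge0 with_density_sigma_additive.

End density.

Section density_integral.
Import HBNNSimple.

Lemma ge0_integral_density (d : measure_display) (T : measurableType d)
    (R : realType) (mu nu : {measure set T -> \bar R}) (f : T -> R)
    (g : T -> \bar R) :
  measurable_fun setT f -> (forall x, 0 <= f x) ->
  (forall A, measurable A -> nu A = \int[mu]_(x in A) (f x)%:E)%E ->
  measurable_fun setT g -> (forall x, 0 <= g x)%E ->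
  (\int[nu]_x g x = \int[mu]_x (g x * (f x)%:E))%E.
Proof.
move=> mf f0 nuE mg g0.
have mEf : measurable_fun setT (EFin \o f) by exact/measurable_EFinP.
pose h := nnsfun_approx measurableT mg.
have hg x : (h n x)%:E @[n --> \oo] --> g x by apply: cvg_nnsfun_approx.
have -> : (\int[nu]_x g x = lim (\int[nu]_x (h n x)%:E @[n --> \oo]))%E.
  rewrite -monotone_convergence//.
  - by apply: eq_integral => x _; apply/esym/cvg_lim => //; exact: hg.
  - by move=> n; exact/measurable_EFinP/measurable_funP.
  - by move=> n x _; rewrite lee_fin.
  - by move=> x _ m n mn; rewrite lee_fin; exact/lefP/nd_nnsfun_approx.
have -> : (\int[mu]_x (g x * (f x)%:E) =
    lim (\int[mu]_x ((h n x)%:E * (f x)%:E) @[n --> \oo]))%E.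
  rewrite -monotone_convergence//.
  - apply: eq_integral => x _; apply/esym/cvg_lim => //.
    by apply: cvgeZr => //; exact: hg.
  - move=> n; apply: emeasurable_funM => //.
    exact/measurable_EFinP/measurable_funP.
  - by move=> n x _; rewrite mule_ge0 ?lee_fin.
  - move=> x _ m n mn; rewrite lee_wpmul2r ?lee_fin//.
    exact/lefP/nd_nnsfun_approx.
congr (lim (_ @ \oo)); apply/funext => n.
have hE x : ((h n x)%:E = \sum_(y \in range (h n))
    (y * \1_(h n @^-1` [set y]) x)%:E)%E by rewrite fsumEFin// -fimfunE.
have mh y : measurable (h n @^-1` [set y]).
  by rewrite -[X in measurable X]setTI; exact: measurable_funP.
have mi y : measurable_fun setT (fun x => (y * \1_(h n @^-1` [set y]) x)%:E).
  by apply/measurable_EFinP/measurable_funM => //; exact: measurable_indic.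
under eq_integral do rewrite hE.
rewrite ge0_integral_fsum//; last first.
  by move=> y x _; exact: nnfun_muleindic_ge0.
under [RHS]eq_integral => x _.
  rewrite hE ge0_mule_fsuml; last by move=> y; exact: nnfun_muleindic_ge0.
  over.
rewrite ge0_integral_fsum//; last 2 first.
- by move=> y; apply: emeasurable_funM.
- by move=> y x _; rewrite mule_ge0 ?lee_fin//; exact: nnfun_muleindic_ge0.
apply: eq_fsbigr => r; rewrite inE => -[x0 _ <-{r}].
set y := h n x0; have y0 : 0 <= y by exact: fun_ge0.
under [in LHS]eq_integral do rewrite EFinM.
rewrite ge0_integralZl//; last first.
  by apply/measurable_EFinP; exact: measurable_indic.
rewrite integral_indic// setIT nuE//.
under [in RHS]eq_integral do rewrite EFinM -muleA.
rewrite ge0_integralZl//; first last.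
- by move=> x _; rewrite mule_ge0 ?lee_fin.
- apply: emeasurable_funM => //.
  by apply/measurable_EFinP; exact: measurable_indic.
congr (_ * _)%E; rewrite integral_mkcond; apply: eq_integral => x _.
rewrite patchE indicE; case: ifPn => _; by rewrite ?mul1e ?mul0e.
Qed.

End density_integral.

(** * Lebesgue measure on R^n *)
Lemma integral_lebesgueRnS (R : realType) n (g : Rn R n.+1 -> \bar R) :
  measurable_fun setT g -> (forall x, 0 <= g x)%E ->
  (\int[lebesgueRn n.+1]_x g x =
   \int[lebesgue_measure]_x \int[lebesgueRn n]_v g (consRn (x, v)))%E.
Proof.
move=> mg g0.
have mc := @measurable_consRn R n.
rewrite [LHS](@ge0_integral_pushforward _ _ _ _ R _ mc)//.
rewrite preimage_setT fubini_tonelli1//; last by move=> x; exact: g0.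
exact: (measurableT_comp mg mc).
Qed.

Lemma tnth_consRn0 (R : realType) n (p : measurableTypeR R * Rn R n) :
  tnth (consRn p) ord0 = p.1.
Proof. by []. Qed.

Lemma tnth_consRnS (R : realType) n (p : measurableTypeR R * Rn R n) (i : 'I_n) :
  tnth (consRn p) (lift ord0 i) = tnth p.2 i.
Proof. by rewrite /consRn tnthS. Qed.

(** Tonelli, one coordinate at a time. *)
Lemma integral_lebesgueRn_prod (R : realType) n
    (f : 'I_n -> measurableTypeR R -> R) :
  (forall i, measurable_fun setT (f i)) -> (forall i x, 0 <= f i x) ->
  (\int[@lebesgueRn R n]_x (\prod_(i < n) f i (tnth x i))%:E =
   \prod_(i < n) \int[lebesgue_measure]_x (f i x)%:E)%E.
Proof.
move=> mf f0; elim: n f mf f0 => [|n IH] f mf f0.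
  under eq_integral do rewrite big_ord0.
  by rewrite integral_dirac//= diracT mul1e big_ord0.
have mp : measurable_fun setT (fun x : Rn R n.+1 => \prod_(i < n.+1) f i (tnth x i)).
  apply: measurable_prod => i _; apply: (measurableT_comp (mf i)).
  exact: measurable_tnth.
have mq : measurable_fun setT
    (fun v : Rn R n => \prod_(i < n) f (lift ord0 i) (tnth v i)).
  apply: measurable_prod => i _; apply: (measurableT_comp (mf _)).
  exact: measurable_tnth.
rewrite integral_lebesgueRnS; last 2 first.
- exact/measurable_EFinP.
- by move=> x; rewrite lee_fin; apply: prodr_ge0.
have inner x : (\int[lebesgueRn n]_v
      (\prod_(i < n.+1) f i (tnth (consRn (x, v)) i))%:E =
    (\prod_(i < n) \int[lebesgue_measure]_x (f (lift ord0 i) x)%:E) *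
      (f ord0 x)%:E)%E.
  rewrite muleC -IH// -ge0_integralZl//; first last.
  - by rewrite lee_fin.
  - by move=> v _; rewrite lee_fin; apply: prodr_ge0.
  - exact/measurable_EFinP.
  apply: eq_integral => v _; rewrite big_ord_recl tnth_consRn0 -EFinM.
  by congr (_ * _)%:E; apply: eq_bigr => i _; rewrite tnth_consRnS.
under eq_integral do rewrite inner.
rewrite big_ord_recl muleC ge0_integralZl//.
- by apply/measurable_EFinP; exact: mf.
- by move=> x _; rewrite lee_fin.
- by apply: prode_ge0 => i _; apply: integral_ge0 => x _; rewrite lee_fin.
Qed.

Definition addRn (R : realType) n (y z : Rn R n) : Rn R n :=
  [tuple tnth y i + tnth z i | i < n].

Lemma measurable_addRn (R : realType) n :
  measurable_fun setT (fun p : Rn R n * Rn R n => addRn p.1 p.2).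
Proof.
apply/measurable_fun_tnthP => i.
rewrite (_ : _ \o _ = fun p : Rn R n * Rn R n => tnth p.1 i + tnth p.2 i); last first.
  by apply/funext => p /=; rewrite tnth_mktuple.
apply: measurable_funD.
- exact: (measurableT_comp (measurable_tnth i) measurable_fst).
- exact: (measurableT_comp (measurable_tnth i) measurable_snd).
Qed.

Lemma measurable_addRnl (R : realType) n (y : Rn R n) :
  measurable_fun setT (addRn y).
Proof. exact: (measurableT_comp (@measurable_addRn R n) (pair1_measurable y)). Qed.

Lemma ge0_integral_shift (R : realType) (a : R) (g : measurableTypeR R -> \bar R) :
  measurable_fun setT g -> (forall x, 0 <= g x)%E ->
  (\int[lebesgue_measure]_x g (a + x)%R = \int[lebesgue_measure]_x g x)%E.
Proof.
move=> mg g0.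
have ms : measurable_fun [set: measurableTypeR R] ((fun x => a + x) : _ -> measurableTypeR R).
  exact: measurable_funD.
rewrite -[LHS](@ge0_integral_pushforward _ _ _ _ R _ ms _ setT g)//.
apply: eq_measure_integral => /= A mA _; apply/esym.
apply: lebesgue_measure_unique => //= _ [[b c]] _ <-.
rewrite /pushforward (_ : _ @^-1` _ = `](b - a), (c - a)]%classic); last first.
  apply/seteqP; split => x /=; rewrite !in_itv/=; lra.
rewrite !lebesgue_measure_itv/= !lte_fin ltrD2r.
by case: ifP => // _; rewrite -!EFinB; congr (_%:E); ring.
Qed.

(** Translation invariance passes from dimension one to dimension n because the
    translation acts on the head and on the tail separately. *)
Lemma ge0_integral_addRn (R : realType) n (y : Rn R n) (g : Rn R n -> \bar R) :
  measurable_fun setT g -> (forall x, 0 <= g x)%E ->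
  (\int[lebesgueRn n]_x g (addRn y x) = \int[lebesgueRn n]_x g x)%E.
Proof.
elim: n y g => [|n IH] y g mg g0.
  by apply: eq_integral => x _; rewrite (tuple0 x) (tuple0 (addRn _ _)).
rewrite !integral_lebesgueRnS//; last exact: (measurableT_comp mg (measurable_addRnl _)).
pose G x := (\int[lebesgueRn n]_v g (consRn (x, v)))%E.
have mgc : measurable_fun setT (fun p : measurableTypeR R * Rn R n => g (consRn p)).
  exact: (measurableT_comp mg (@measurable_consRn R n)).
have mG : measurable_fun setT G.
  exact: (measurable_fun_fubini_tonelli_F (fun p => g (consRn p))).
rewrite -[RHS](ge0_integral_shift (thead y) mG); last first.
  by move=> x; apply: integral_ge0.
apply: eq_integral => x _; rewrite /G.
rewrite -[RHS](IH [tuple of behead y]); last 2 first.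
- exact: (measurableT_comp mgc (pair1_measurable _)).
- by [].
apply: eq_integral => v _; congr g; apply: eq_from_tnth => i.
rewrite tnth_mktuple; have [<-|/unlift_some[j -> _]] := eqVneq ord0 i; first by [].
rewrite !tnth_consRnS /= tnth_mktuple; congr (_ + _).
by rewrite [in LHS](tuple_eta y) tnthS.
Qed.

(** * Gaussian increments *)
Definition box (R : realType) n (A : 'I_n -> set (measurableTypeR R)) :
  set (Rn R n) := [set z | forall i, A i (tnth z i)].

Lemma measurable_box (R : realType) n (A : 'I_n -> set (measurableTypeR R)) :
  (forall i, measurable (A i)) -> measurable (box A).
Proof.
move=> mA; rewrite (_ : box A = \bigcap_(i in [set: 'I_n]) ((@tnth n _)^~ i @^-1` A i)).
  apply: fin_bigcap_measurable => // i _; rewrite -[X in measurable X]setTI.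
  exact: measurable_tnth.
by apply/seteqP; split => [z zA i _|z zA i]; exact: zA.
Qed.

(** Boxes are stable under intersection and generate the product
    sigma-algebra; this is what turns the coordinatewise description of the
    increments of a Brownian motion into their law on R^n. *)
Lemma measure_unique_box (R : realType) n (m1 m2 : {measure set (Rn R n) -> \bar R}) :
  (m1 setT < +oo)%E ->
  (forall A, (forall i, measurable (A i)) -> m1 (box A) = m2 (box A)) ->
  forall B, measurable B -> m1 B = m2 B.
Proof.
move=> m1oo m12.
pose G := [set B | exists2 A, (forall i, measurable (A i)) & B = @box R n A].
have GT : G setT.
  by exists (fun=> setT) => //; apply/seteqP; split.
apply: (measure_unique G (fun=> setT)) => //.
- apply/seteqP; split; apply: smallest_sub.
  + exact: smallest_sigma_algebra.
  + elim/big_ind : _ => [//|B C BG CG|i _]; first by rewrite subUset.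
    move=> _ [B mB <-]; apply: sub_sigma_algebra.
    exists (fun j => if j == i then B else setT).
      by move=> j; case: ifP.
    apply/seteqP; split => [z [_ zB] j|z /(_ i)].
      by case: eqVneq => // ->.
    by rewrite eqxx.
  + exact: sigma_algebra_measurable.
  + by move=> _ [A mA ->]; exact: measurable_box.
- move=> _ _ [A mA ->] [B mB ->]; exists (fun i => A i `&` B i).
    by move=> i; exact: measurableI.
  by apply/seteqP; split => [z [zA zB] i|z zAB]; [split; [exact: zA|exact: zB]|
    split => i; have [] := zAB i].
- by apply/seteqP; split => // z _; exists 0%N.
- by move=> _ [A mA ->]; exact: m12.
Qed.

Definition gauss_pdf (R : realType) n (s : R) (z : Rn R n) : R :=
  \prod_(i < n) normal_pdf 0 s (tnth z i).

Lemma measurable_gauss_pdf (R : realType) n (s : R) :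
  measurable_fun setT (@gauss_pdf R n s).
Proof.
apply: measurable_prod => i _.
apply: (measurableT_comp (measurable_normal_pdf 0 s)); exact: measurable_tnth.
Qed.

Lemma gauss_pdf_ge0 (R : realType) n (s : R) z : 0 <= @gauss_pdf R n s z.
Proof. by apply: prodr_ge0 => i _; exact: normal_pdf_ge0. Qed.

Lemma gauss_pdf_ub (R : realType) n (s : R) z :
  s != 0 -> @gauss_pdf R n s z <= normal_peak s ^+ n.
Proof.
move=> s0; rewrite -[X in _ ^+ X]card_ord -prodr_const; apply: ler_prod => i _.
by rewrite normal_pdf_ge0 normal_pdf_ub.
Qed.

(** The centered Gaussian law of covariance s^2 I_n. It is given by its density
    with respect to Lebesgue measure so that the bound of the density is
    available directly. *)
Definition gaussRn (R : realType) n (s : R) : set (Rn R n) -> \bar R :=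
  with_density (lebesgueRn n) (@measurable_gauss_pdf R n s) (@gauss_pdf_ge0 R n s).

HB.instance Definition _ (R : realType) n (s : R) := Measure.on (@gaussRn R n s).

Lemma gaussRn_box (R : realType) n (s : R) A : (forall i, measurable (A i)) ->
  gaussRn s (@box R n A) = (\prod_(i < n) normal_prob 0 s (A i))%E.
Proof.
move=> mA; rewrite /gaussRn /with_density integral_mkcond.
transitivity (\int[lebesgueRn n]_x
    (\prod_(i < n) (normal_pdf 0 s (tnth x i) * \1_(A i) (tnth x i)))%:E)%E.
  apply: eq_integral => x _; rewrite patchE big_split/=; case: ifPn => xA.
    rewrite [X in _ * X]big1 ?mulr1// => i _.
    by rewrite indicE mem_set//; move: xA; rewrite inE; exact.
  have : ~ box A x by move=> h; move: xA; rewrite mem_set.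
  move=> /existsNP[i xAi].
  by rewrite [X in _ * X](bigD1 i)//= indicE memNset// mul0r mulr0.
rewrite (@integral_lebesgueRn_prod R n (fun i x => normal_pdf 0 s x * \1_(A i) x)).
- apply: eq_bigr => i _; rewrite /normal_prob [RHS]integral_mkcond.
  apply: eq_integral => x _; rewrite patchE indicE; case: ifPn => _.
    by rewrite mulr1.
  by rewrite mulr0.
- move=> i; apply: measurable_funM; first exact: measurable_normal_pdf.
  exact: measurable_indic.
- by move=> i x; rewrite mulr_ge0// normal_pdf_ge0.
Qed.

Lemma gaussRn_setT (R : realType) n (s : R) : @gaussRn R n s setT = 1%E.
Proof.
rewrite (_ : setT = box (fun=> setT)); last by apply/seteqP; split.
by rewrite gaussRn_box// big1// => i _; exact: probability_setT.
Qed.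

HB.instance Definition _ (R : realType) n (s : R) :=
  @Measure_isProbability.Build _ _ R (@gaussRn R n s) (@gaussRn_setT R n s).

Lemma integral_gaussRn_le (R : realType) n (s : R) (g : Rn R n -> \bar R) :
  s != 0 -> measurable_fun setT g -> (forall x, 0 <= g x)%E ->
  (\int[gaussRn s]_x g x <= (normal_peak s ^+ n)%:E * \int[lebesgueRn n]_x g x)%E.
Proof.
move=> s0 mg g0.
have mpdf := @measurable_gauss_pdf R n s.
rewrite (@ge0_integral_density _ _ _ (lebesgueRn n) _ (gauss_pdf s))//;
  last exact: gauss_pdf_ge0.
rewrite -ge0_integralZl//; last by rewrite lee_fin exprn_ge0// normal_peak_ge0.
apply: ge0_le_integral => //.
- by move=> x _; rewrite mule_ge0// lee_fin gauss_pdf_ge0.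
- by apply: emeasurable_funM => //; exact/measurable_EFinP.
- exact: emeasurable_funM.
- by move=> x _; rewrite muleC lee_wpmul2r// lee_fin gauss_pdf_ub.
Qed.

Lemma measurable_incr (R : realType) n d (Omega : measurableType d)
    (X : R -> Omega -> Rn R n) s t :
  measurable_fun setT (X s) -> measurable_fun setT (X t) ->
  measurable_fun setT (incr X s t).
Proof.
move=> ms mt; apply/measurable_fun_tnthP => i.
rewrite (_ : _ \o _ = fun w => tnth (X t w) i - tnth (X s w) i); last first.
  by apply/funext => w /=; rewrite tnth_mktuple.
by apply: measurable_funB; exact: (measurableT_comp (measurable_tnth i)).
Qed.

Lemma incr_gaussian (R : realType) n d (Omega : measurableType d)
    (P : probability Omega R) (X : R -> Omega -> Rn R n) x (s t : R) B :
  brownian_motion P X x -> 0 <= s -> s < t -> measurable B ->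
  P (incr X s t @^-1` B) = gaussRn (Num.sqrt (t - s)) B.
Proof.
move=> bm s0 st mB.
have mi : measurable_fun setT (incr X s t).
  by apply: measurable_incr; apply: (bm_measurable bm); lra.
apply/esym/(@measure_unique_box _ _ (gaussRn (Num.sqrt (t - s))) (pushforward P (incr X s t))).
- by rewrite [X in (X < _)%E](@gaussRn_setT R n) ltry.
- move=> A mA; transitivity (\prod_(i < n) normal_prob 0 (Num.sqrt (t - s)) (A i))%E.
    exact: gaussRn_box.
  by rewrite -(bm_gaussian bm).
- by [].
Qed.

(** * The Markov property *)
Lemma ge0_integral_indep (R : realType) d d1 d2 (Omega : measurableType d)
    (T1 : measurableType d1) (T2 : measurableType d2) (P : probability Omega R)
    (H : Omega -> T1) (Z : Omega -> T2) (gam : probability T2 R)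
    (F : T1 * T2 -> \bar R) :
  measurable_fun setT H -> measurable_fun setT Z ->
  (forall A B, measurable A -> measurable B ->
    P (H @^-1` A `&` Z @^-1` B) = P (H @^-1` A) * gam B)%E ->
  measurable_fun setT F -> (forall x, 0 <= F x)%E ->
  (\int[P]_w F (H w, Z w) = \int[P]_w \int[gam]_z F (H w, z))%E.
Proof.
move=> mH mZ HZ mF F0.
pose Hm : {mfun Omega >-> T1} := HB.pack H (isMeasurableFun.Build _ _ _ _ _ mH).
have mHZ : measurable_fun setT (fun w => (H w, Z w)) by exact: measurable_fun_pair.
pose HZm : {mfun Omega >-> (T1 * T2)%type} :=
  HB.pack (fun w => (H w, Z w)) (isMeasurableFun.Build _ _ _ _ _ mHZ).
transitivity (\int[distribution P HZm]_x F x)%E.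
  by rewrite ge0_integral_distribution.
transitivity (\int[distribution P Hm \x gam]_x F x)%E.
  apply: eq_measure_integral => A mA _; apply/esym.
  by apply: product_measure_unique => // B C mB mC; exact: HZ.
rewrite fubini_tonelli1// ge0_integral_distribution//.
- exact: measurable_fun_fubini_tonelli_F.
- by move=> x; apply: integral_ge0.
Qed.

(** The heat semigroup, parametrized by the standard deviation s rather than by
    the time s^2. *)
Definition heat (R : realType) n (s : R) (g : Rn R n -> \bar R) (y : Rn R n) : \bar R :=
  (\int[gaussRn s]_z g (addRn y z))%E.

Lemma heat_ge0 (R : realType) n (s : R) (g : Rn R n -> \bar R) y :
  (forall x, 0 <= g x)%E -> (0 <= heat s g y)%E.
Proof. by move=> g0; apply: integral_ge0. Qed.

Lemma measurable_heat (R : realType) n (s : R) (g : Rn R n -> \bar R) :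
  measurable_fun setT g -> (forall x, 0 <= g x)%E ->
  measurable_fun setT (heat s g).
Proof.
move=> mg g0.
apply: (measurable_fun_fubini_tonelli_F (fun p => g (addRn p.1 p.2))) => //.
exact: (measurableT_comp mg (@measurable_addRn R n)).
Qed.

(** The L^2 to L^infinity bound of the heat semigroup: the Gaussian density is
    bounded by c and Lebesgue measure is translation invariant, so that
    int g^2(y + z) dgamma(z) <= c N^2 for every y. *)
Lemma heat_le_L2 (R : realType) n (s : R) : s != 0 ->
  exists2 K : R, 0 < K & forall (g : Rn R n -> R) (N : R) y,
    measurable_fun setT g -> (forall x, 0 <= g x) -> 0 < N ->
    (\int[lebesgueRn n]_x (g x ^+ 2)%:E <= (N ^+ 2)%:E)%E ->
    (heat s (EFin \o g) y <= (K * N)%:E)%E.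
Proof.
move=> s0; set c := normal_peak s ^+ n.
have c0 : 0 <= c by rewrite exprn_ge0// normal_peak_ge0.
exists ((c + 1) / 2) => [|g N y mg g0 N0 gN]; first by lra.
have mga : measurable_fun setT (g \o addRn y).
  exact: (measurableT_comp mg (measurable_addRnl y)).
have mg2 : measurable_fun setT (fun x => (g x ^+ 2)%:E).
  by apply/measurable_EFinP; exact: measurable_funX.
have mg2a : measurable_fun setT (fun x => (g (addRn y x) ^+ 2)%:E).
  exact: (measurableT_comp mg2 (measurable_addRnl y)).
have h2 : (\int[gaussRn s]_z (g (addRn y z) ^+ 2)%:E <= (c * N ^+ 2)%:E)%E.
  apply: (le_trans (integral_gaussRn_le s0 mg2a _)).
    by move=> x; rewrite lee_fin sqr_ge0.
  rewrite (@ge0_integral_addRn _ _ y (fun x => (g x ^+ 2)%:E))//; last first.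
    by move=> x; rewrite lee_fin sqr_ge0.
  by rewrite EFinM lee_wpmul2l// lee_fin.
(* a <= (a^2 / N + N) / 2 replaces the Cauchy-Schwarz inequality *)
apply: (@le_trans _ _ (\int[gaussRn s]_z
    ((2 * N)^-1%:E * (g (addRn y z) ^+ 2)%:E + (N / 2)%:E))%E).
  apply: ge0_le_integral => //.
  - by move=> z _; rewrite lee_fin.
  - exact/measurable_EFinP.
  - apply: emeasurable_funD => //; exact: measurable_funeM.
  - move=> z _; rewrite -EFinM -EFinD lee_fin; set a := g _.
    rewrite -subr_ge0 (_ : _ - _ = (2 * N)^-1 * (a - N) ^+ 2); last by field; lra.
    by rewrite mulr_ge0 ?sqr_ge0// invr_ge0; lra.
have N2 : 0 <= (2 * N)^-1 by rewrite invr_ge0; lra.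
rewrite ge0_integralD//; first last.
- by move=> z _; rewrite lee_fin; lra.
- exact: measurable_funeM.
- by move=> z _; rewrite mule_ge0 ?lee_fin ?sqr_ge0.
rewrite ge0_integralZl//; last by move=> z _; rewrite lee_fin sqr_ge0.
rewrite integral_cst// [X in (_ + _ * X)%E](@gaussRn_setT R n) mule1.
apply: (@le_trans _ _ ((2 * N)^-1%:E * (c * N ^+ 2)%:E + (N / 2)%:E)%E).
  by rewrite leeD2r// lee_wpmul2l// lee_fin.
rewrite -EFinM -EFinD lee_fin le_eqVlt; apply/orP; left; apply/eqP.
by field; lra.
Qed.

Section past.
Context {R : realType} {n : nat} {d : measure_display} {Omega : measurableType d}.
Variable X : R -> Omega -> Rn R n.

(** [past X s] is the sigma-algebra generated by this family; as a measurable
    type it allows one to speak of past-measurable functions. *)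
Definition past_generator (s : R) : set (set Omega) :=
  [set E | exists (r : R) (B : set (Rn R n)),
    [/\ 0 <= r, r <= s, measurable B & E = X r @^-1` B] ].

Definition pastType (s : R) := g_sigma_algebraType (past_generator s).

Lemma measurable_past (s r : R) : 0 <= r -> r <= s ->
  measurable_fun [set: pastType s] (X r).
Proof.
move=> r0 rs _ B mB; rewrite setTI; apply: sub_sigma_algebra.
by exists r, B.
Qed.

Lemma past_sub_measurable (s : R) : (forall t : R, 0 <= t -> measurable_fun setT (X t)) ->
  forall d' (T : measurableType d') (W : Omega -> T),
  measurable_fun [set: pastType s] W -> measurable_fun [set: Omega] W.
Proof.
move=> mX d' T W mW _ B mB; have := mW measurableT B mB; apply: smallest_sub.
  exact: sigma_algebra_measurable.
by move=> _ [r [C [r0 _ mC ->]]]; rewrite -[X in measurable X]setTI; exact: mX.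
Qed.

(** Given the past up to time s, X_t is X_s plus an independent Gaussian vector,
    hence the joint law of ((W, X_s), X_t - X_s) is a product and Tonelli
    integrates the increment first. *)
Lemma markov (P : probability Omega R) x (s t : R) (W : Omega -> R) (g : Rn R n -> \bar R) :
  brownian_motion P X x -> 0 <= s -> s < t ->
  measurable_fun [set: pastType s] W -> (forall w, 0 <= W w) ->
  measurable_fun setT g -> (forall y, 0 <= g y)%E ->
  (\int[P]_w ((W w)%:E * g (X t w)) =
   \int[P]_w ((W w)%:E * heat (Num.sqrt (t - s)) g (X s w)))%E.
Proof.
move=> bm s0 st mW W0 mg g0; have mX := bm_measurable bm.
have mH : measurable_fun [set: pastType s] (fun w => (W w, X s w)).
  by apply: measurable_fun_pair => //; exact: measurable_past.
(* the absolute value makes F nonnegative on the whole product *)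
pose F (p : (R * Rn R n) * Rn R n) := (`|p.1.1|%:E * g (addRn p.1.2 p.2))%E.
transitivity (\int[P]_w F ((W w, X s w), incr X s t w))%E.
  apply: eq_integral => w _; rewrite /F/= ger0_norm//; congr (_ * g _)%E.
  by apply: eq_from_tnth => i; rewrite !tnth_mktuple addrC subrK.
have mF : measurable_fun setT F.
  apply: emeasurable_funM.
    apply/measurable_EFinP; apply: measurableT_comp => //.
    exact: (measurableT_comp measurable_fst).
  apply: (measurableT_comp mg).
  have mp : measurable_fun setT (fun p : (R * Rn R n) * Rn R n => (p.1.2, p.2)).
    apply: measurable_fun_pair => //.
    exact: (measurableT_comp measurable_snd).
  exact: (measurableT_comp (@measurable_addRn R n) mp).
rewrite (@ge0_integral_indep _ _ _ _ _ _ _ P _ _ (gaussRn (Num.sqrt (t - s)))).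
- apply: eq_integral => w _; rewrite /F/= ger0_norm// ge0_integralZl//.
    exact: (measurableT_comp mg (measurable_addRnl _)).
  by rewrite lee_fin.
- exact: (past_sub_measurable mX mH).
- by apply: measurable_incr; apply: mX; lra.
- move=> A B mA mB; rewrite (bm_independent bm)//.
    by rewrite (incr_gaussian bm).
  by have := mH measurableT A mA; rewrite setTI.
- exact: mF.
- by move=> p; rewrite mule_ge0 ?lee_fin.
Qed.

End past.

(** * Riemann sums *)
Lemma heine_cantor (R : realType) (K : set R) (phi : R -> R) (eps : R) :
  compact K -> {within K, continuous phi} -> 0 < eps ->
  exists2 eta, 0 < eta & forall x y, K x -> K y -> `|x - y| < eta ->
    `|phi x - phi y| < eps.
Proof.
move=> /compact_near_coveringP/near_covering_withinP cK.
move=> /subspace_continuousP cphi e0.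
have e2 : 0 < eps / 2 by lra.
pose P (eta x : R) := forall y, K y -> `|x - y| < eta -> `|phi x - phi y| < eps.
have : \forall eta \near 0^'+, K `<=` P eta.
  apply: cK => x Kx.
  have /cvgrPdist_lt/(_ _ e2) := cphi x Kx.
  rewrite near_withinE => /nbhs_ballP[r /= r0 xr].
  exists (ball x (r / 2), [set eta | eta < r / 2]).
    split; first by apply: nbhsx_ballx; rewrite divr_gt0.
    by apply: nbhs_right_lt; rewrite divr_gt0.
  move=> [x' eta] /= [xx' etar] Kx' y Ky x'y.
  have h1 : `|phi x - phi x'| < eps / 2.
    by apply: xr => //; rewrite /ball/= (lt_trans xx')//; lra.
  have h2 : `|phi x - phi y| < eps / 2.
    apply: xr => //; rewrite /ball/=.
    rewrite (_ : x - y = (x - x') + (x' - y)); last by ring.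
    by rewrite (le_lt_trans (ler_normD _ _))//; move: xx'; rewrite /ball/=; lra.
  rewrite (_ : phi x' - phi y = (phi x - phi y) - (phi x - phi x')); last by ring.
  by rewrite (le_lt_trans (ler_normB _ _))//; lra.
move=> KP; near (0 : R)^'+ => eta; exists eta => // x y Kx; move: y.
by apply: (near KP eta _ x Kx).
Unshelve. all: by end_near. Qed.

Section riemann.
Context {R : realType}.
Local Notation mu := (@lebesgue_measure R).

Lemma Rintegral_near_cst (phi : R -> R) (a b c eps : R) : a <= b ->
  mu.-integrable `]a, b] (EFin \o phi) ->
  (forall x, a < x <= b -> `|phi x - c| <= eps) ->
  `|\int[mu]_(x in `]a, b]) phi x - c * (b - a)| <= eps * (b - a).
Proof.
move=> ab iphi phic.
have cstE k : \int[mu]_(x in `]a, b]) k = k * (b - a).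
  rewrite Rintegral_cst//= lebesgue_measure_itv/= lte_fin.
  case: ltP => //= ba.
  by have -> : a = b; [lra|rewrite subrr].
have icst k : mu.-integrable `]a, b] (EFin \o cst k).
  apply: (@integrableS _ _ _ mu `[a, b]) => //.
    by apply: subset_itvr; rewrite bnd_simp.
  apply: continuous_compact_integrable; first exact: segment_compact.
  by apply: continuous_subspaceT => x; exact: cvg_cst.
rewrite ler_norml; apply/andP; split.
  rewrite lerBrDr (_ : _ + _ = (c - eps) * (b - a)); last by ring.
  rewrite -cstE; apply: le_Rintegral => //; first exact: (icst (c - eps)).
  move=> x /=; rewrite in_itv/= => /phic.
  by rewrite ler_norml; lra.
rewrite lerBlDr (_ : _ + _ = (c + eps) * (b - a)); last by ring.
rewrite -cstE; apply: le_Rintegral => //; first exact: (icst (c + eps)).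
move=> x /=; rewrite in_itv/= => /phic.
by rewrite ler_norml; lra.
Qed.

Lemma cvg_riemann_sum (phi : R -> R) (t : R) : 0 < t ->
  {within `[0, t], continuous phi} ->
  (t / N.+1%:R * \sum_(k < N.+1) phi (k%:R * (t / N.+1%:R))) @[N --> \oo] -->
    \int[mu]_(s in `[0, t]) phi s.
Proof.
move=> t0 cphi.
have iphi : mu.-integrable `[0, t] (EFin \o phi).
  by apply: continuous_compact_integrable => //; exact: segment_compact.
apply/cvgrPdist_le => eps eps0.
have et0 : 0 < eps / t by rewrite divr_gt0.
have [eta eta0 phieta] := heine_cantor (@segment_compact R 0 t) cphi et0.
near=> N.
set dl := t / N.+1%:R; have dl0 : 0 < dl by rewrite divr_gt0.
have Ndl : N.+1%:R * dl = t by rewrite /dl mulrCA divff ?mulr1// pnatr_eq0.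
have dleta : dl < eta.
  rewrite /dl -ltr_pdivlMl// mulrC.
  by near: N; exact: (near_infty_natSinv_lt (PosNum (divr_gt0 eta0 t0))).
have kdl k : (k <= N.+1)%N -> k%:R * dl <= t.
  by move=> kN; rewrite -Ndl ler_wpM2r ?ler_nat// ltW.
(* each of the first k cells contributes an error of at most dl * eps / t *)
suff step k : (k <= N.+1)%N ->
    `|\int[mu]_(s in `[0, k%:R * dl]) phi s -
      dl * \sum_(j < k) phi (j%:R * dl)| <= eps / t * (k%:R * dl).
  have := step N.+1 (leqnn _).
  by rewrite Ndl divfK// gt_eqF.
elim: k => [_|k IH kN].
  rewrite mul0r set_itv1 Rintegral_set1 big_ord0 mulr0 subrr normr0.
  by rewrite mulr0.
have kk : k%:R * dl <= k.+1%:R * dl by rewrite ler_pM2r// ler_nat.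
have k0 : 0 <= k%:R * dl by rewrite mulr_ge0// ltW.
have isub : mu.-integrable `[0, k.+1%:R * dl] (EFin \o phi).
  apply: (@integrableS _ _ _ mu `[0, t]) => //.
  by apply: subset_itvl; rewrite bnd_simp kdl.
have := @Rintegral_itvB R phi (BLeft 0) (BRight (k.+1%:R * dl)) (k%:R * dl) isub.
rewrite !bnd_simp k0 => /(_ isT kk) splitI.
rewrite big_ord_recr/=.
have -> : \int[mu]_(s in `[0, k.+1%:R * dl]) phi s =
    \int[mu]_(s in `[0, k%:R * dl]) phi s +
    \int[mu]_(s in `]k%:R * dl, k.+1%:R * dl]) phi s by rewrite -splitI; ring.
set I1 := Rintegral _ _ _; set I2 := Rintegral _ _ _.
have d1 : k.+1%:R * dl - k%:R * dl = dl by rewrite -natr1; ring.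
have I2P : `|I2 - phi (k%:R * dl) * dl| <= eps / t * dl.
  rewrite -{2 3}d1; apply: Rintegral_near_cst => //.
    apply: (@integrableS _ _ _ mu `[0, k.+1%:R * dl]) => //.
    by apply: subset_itvr; rewrite bnd_simp.
  move=> x /andP[kx xk]; apply/ltW; apply: phieta => /=.
  - have := kdl _ kN; rewrite in_itv/= => kt.
    by apply/andP; split; lra.
  - by rewrite in_itv/= k0 kdl// ltnW.
  - by rewrite ger0_norm; lra.
have {}IH := IH (ltnW kN).
rewrite (_ : _ - _ = (I1 - dl * \sum_(j < k) phi (j%:R * dl)) +
  (I2 - phi (k%:R * dl) * dl)); last by ring.
rewrite (le_trans (ler_normD _ _))// (le_trans (lerD IH I2P))//.
by rewrite -mulrDr -natr1 mulrDl mul1r.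
Unshelve. all: by end_near. Qed.

End riemann.

(** * Derivatives of the potential *)
Lemma cvg_glue (R : realType) (T : Type) (F : set_system T) (f p q : T -> R) (l : R) :
  Filter F -> (\forall x \near F, f x = p x \/ f x = q x) ->
  p x @[x --> F] --> l -> q x @[x --> F] --> l -> f x @[x --> F] --> l.
Proof.
move=> FF fpq /cvgrPdist_lt pl /cvgrPdist_lt ql.
apply/cvgrPdist_lt => e e0; near=> x.
have [->|->] : f x = p x \/ f x = q x by near: x.
- by near: x; exact: pl.
- by near: x; exact: ql.
Unshelve. all: by end_near. Qed.

(** At a junction point, the difference quotients of a piecewise function are
    difference quotients of one of the two pieces. Taking p = q gives the
    locality of the derivative. *)
Lemma is_derive_glue (R : realType) (f p q : R -> R) (a l : R) :
  (\forall x \near a, f x = p x \/ f x = q x) -> f a = p a -> f a = q a ->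
  is_derive a 1 p l -> is_derive a 1 q l -> is_derive a 1 f l.
Proof.
move=> fpq fpa fqa [dp pl] [dq ql].
pose Q (g : R -> R) (h : R) := h^-1 *: ((g \o shift a) (h *: 1) - g a).
have Qf : Q f h @[h --> 0^'] --> l.
  apply: (@cvg_glue _ _ _ (Q f) (Q p) (Q q)).
  - have : h + a @[h --> 0^'] --> a.
      rewrite -[X in _ --> X]add0r.
      apply: cvgD; last exact: cvg_cst.
      exact: nbhs_dnbhs.
    move=> /(_ _ fpq) fpqa; near=> h; rewrite /Q /= [h *: 1]mulr1.
    have [->|->] : f (h + a) = p (h + a) \/ f (h + a) = q (h + a).
    + by near: h; exact: fpqa.
    + by left; rewrite fpa.
    + by right; rewrite fqa.
  - by rewrite -pl; exact: dp.
  - by rewrite -ql; exact: dq.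
by split; [apply/cvg_ex; exists l|apply/cvg_lim].
Unshelve. all: by end_near. Qed.

(** The derivative is written with the exponent b - 2, as x |x|^(b-2), so that one
    formula covers both signs of x. *)
Lemma is_derive_norm_powR (R : realType) (b x : R) : x != 0 ->
  is_derive x 1 (fun y : R => `|y| `^ b) (b * x * `|x| `^ (b - 2)).
Proof.
move=> x0.
have absx : `|x| `^ (b - 1) = `|x| * `|x| `^ (b - 2).
  rewrite (_ : b - 1 = 1 + (b - 2)); last by ring.
  by rewrite [LHS]powRD ?powRr1// normr_eq0 x0 implybT.
have [xlt|xgt|] := ltgtP x 0; last by move/eqP; rewrite (negbTE x0).
- have nx : 0 < - x by lra.
  have d := is_derive1_comp (is_derive1_powR b nx) (is_deriveNid x 1).
  have E : (b * (- x) `^ (b - 1)) *: (- 1 : R) = b * x * `|x| `^ (b - 2).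
    rewrite -(ltr0_norm xlt) absx ltr0_norm// [LHS]/GRing.scale/=; ring.
  apply: (@is_derive_glue _ _ (fun y => (- y) `^ b) (fun y => (- y) `^ b)).
  + have : \forall y \near x, y < 0 by exact: lt_nbhsl.
    by apply: filterS => y y0; left; rewrite ltr0_norm.
  + by rewrite ltr0_norm.
  + by rewrite ltr0_norm.
  + exact: is_derive_eq d E.
  + exact: is_derive_eq d E.
- have E : b * x `^ (b - 1) = b * x * `|x| `^ (b - 2).
    by rewrite -{1}(gtr0_norm xgt) absx gtr0_norm// mulrA.
  apply: (@is_derive_glue _ _ (fun y => y `^ b) (fun y => y `^ b)).
  + have : \forall y \near x, 0 < y by exact: lt_nbhsr.
    by apply: filterS => y y0; left; rewrite gtr0_norm.
  + by rewrite gtr0_norm.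
  + by rewrite gtr0_norm.
  + exact: is_derive_eq (is_derive1_powR b xgt) E.
  + exact: is_derive_eq (is_derive1_powR b xgt) E.
Qed.

Section one_dim_potential.
Context {R : realType} (alpha : R).
Implicit Types x y : R.

Definition u_inner x : R :=
  alpha * (alpha - 2) / 8 * x ^+ 4 + alpha * (4 - alpha) / 4 * x ^+ 2
  + (1 - 3 / 4 * alpha + 1 / 8 * alpha ^+ 2).

Definition du_inner x : R :=
  alpha * (alpha - 2) / 2 * x ^+ 3 + alpha * (4 - alpha) / 2 * x.

Definition ddu_inner x : R :=
  3 * alpha * (alpha - 2) / 2 * x ^+ 2 + alpha * (4 - alpha) / 2.

Definition du_outer x : R := alpha * x * `|x| `^ (alpha - 2).

Definition ddu_outer x : R := alpha * (alpha - 1) * `|x| `^ (alpha - 2).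

Definition du x : R := if 1 < `|x| then du_outer x else du_inner x.
Definition ddu x : R := if 1 < `|x| then ddu_outer x else ddu_inner x.

Lemma near_glue (T : Type) (p q : R -> T) x :
  let f y := if 1 < `|y| then q y else p y in
  [\/ `|x| < 1 /\ \forall y \near x, f y = p y,
      1 < `|x| /\ \forall y \near x, f y = q y |
      `|x| = 1].
Proof.
move=> f; have cn : `|y| @[y --> x] --> `|x| by apply: cvg_norm; exact: cvg_id.
have [xlt|xgt|] := ltgtP `|x| 1; last by move=> ?; apply: Or33.
- apply: Or31; split => //.
  have h := cn _ (lt_nbhsl xlt); near=> y.
  have y1 : `|y| < 1 by near: y; exact: h.
  by rewrite /f ltNge (ltW y1).
- apply: Or32; split => //.
  have h := cn _ (lt_nbhsr xgt); near=> y.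
  have y1 : 1 < `|y| by near: y; exact: h.
  by rewrite /f y1.
Unshelve. all: by end_near. Qed.

(** The pieces of u_alpha and of its derivative meet at |x| = 1, where they have
    the same value and the same slope; q need not be smooth at 0. *)
Lemma is_derive_piecewise (p dp q dq : R -> R) x :
  is_derive x 1 p (dp x) -> (x != 0 -> is_derive x 1 q (dq x)) ->
  (`|x| = 1 -> p x = q x /\ dp x = dq x) ->
  is_derive x 1 (fun y => if 1 < `|y| then q y else p y)
                (if 1 < `|x| then dq x else dp x).
Proof.
move=> dpx dqx x1.
case: (near_glue p q x) => [[xlt nx]|[xgt nx]|xeq].
- rewrite ltNge (ltW xlt)/=.
  apply: (@is_derive_glue _ _ p p) => //.
  + by apply: filterS nx => y ->; left.
  + by rewrite ltNge (ltW xlt).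
  + by rewrite ltNge (ltW xlt).
- have x0 : x != 0 by rewrite -normr_gt0; lra.
  rewrite xgt; apply: (@is_derive_glue _ _ q q) => //.
  + by apply: filterS nx => y ->; left.
  + by rewrite xgt.
  + by rewrite xgt.
  + exact: dqx.
  + exact: dqx.
- have [pq dpq] := x1 xeq.
  have x0 : x != 0 by rewrite -normr_gt0; lra.
  rewrite xeq ltxx; apply: (@is_derive_glue _ _ p q).
  + by near=> y; case: ifP => _; [right|left].
  + by rewrite xeq ltxx.
  + by rewrite xeq ltxx.
  + by rewrite dpq; exact: dqx.
Unshelve. all: by end_near. Qed.

Lemma cvg_piecewise (p q : R -> R) : continuous p ->
  (forall x, x != 0 -> q y @[y --> x] --> q x) ->
  (forall x, `|x| = 1 -> p x = q x) ->
  continuous (fun y => if 1 < `|y| then q y else p y).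
Proof.
move=> cp cq pq x.
case: (near_glue p q x) => [[xlt nx]|[xgt nx]|xeq].
- rewrite /continuous_at ltNge (ltW xlt)/=.
  apply: (@cvg_glue _ _ _ _ p p) => //; try exact: cp.
  by apply: filterS nx => y ->; left.
- have x0 : x != 0 by rewrite -normr_gt0; lra.
  rewrite /continuous_at xgt.
  apply: (@cvg_glue _ _ _ _ q q) => //; try exact: cq.
  by apply: filterS nx => y ->; left.
- have x0 : x != 0 by rewrite -normr_gt0; lra.
  rewrite /continuous_at xeq ltxx.
  apply: (@cvg_glue _ _ _ _ p q).
  + by near=> y; case: ifP => _; [right|left].
  + exact: cp.
  + by rewrite pq//; exact: cq.
Unshelve. all: by end_near. Qed.

Lemma normr1_sqr x : `|x| = 1 -> x ^+ 2 = 1.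
Proof. by move=> x1; rewrite -[LHS]ger0_norm ?sqr_ge0// normrX x1 expr1n. Qed.

Lemma is_derive_u_alpha x : is_derive x 1 (u_alpha alpha) (du x).
Proof.
apply: (@is_derive_piecewise u_inner du_inner (fun y => `|y| `^ alpha) du_outer).
- have dX k : is_derive x 1 (fun y : R => y ^+ k) (k%:R * x ^+ k.-1).
    by split; [exact: exprn_derivable|rewrite exp_derive [LHS]mulr1].
  have d1 := is_deriveD (is_deriveD
    (is_deriveZ (alpha * (alpha - 2) / 8) (dX 4%N))
    (is_deriveZ (alpha * (4 - alpha) / 4) (dX 2%N)))
    (is_derive_cst (1 - 3 / 4 * alpha + 1 / 8 * alpha ^+ 2) x 1).
  apply: (is_derive_eq d1).
  by rewrite /du_inner /= /GRing.scale /=; field.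
- by move=> x0; exact: (is_derive_norm_powR alpha x0).
- move=> x1; have x2 := normr1_sqr x1.
  rewrite /u_inner /du_inner /du_outer x1 !powR1; split.
    by rewrite (exprM x 2 2) x2; field.
  by rewrite exprS x2; field.
Qed.

Lemma is_derive_du x : is_derive x 1 du (ddu x).
Proof.
apply: (@is_derive_piecewise du_inner ddu_inner du_outer ddu_outer).
- have dX k : is_derive x 1 (fun y : R => y ^+ k) (k%:R * x ^+ k.-1).
    by split; [exact: exprn_derivable|rewrite exp_derive [LHS]mulr1].
  have d1 := is_deriveD
    (is_deriveZ (alpha * (alpha - 2) / 2) (dX 3%N))
    (is_deriveZ (alpha * (4 - alpha) / 2) (is_derive_id x 1)).
  apply: (is_derive_eq d1).
  by rewrite /ddu_inner /= /GRing.scale /=; field.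
- move=> x0.
  have d1 := is_derive_norm_powR (alpha - 2) x0.
  have d2 := is_deriveM (is_deriveZ alpha (is_derive_id x 1)) d1.
  apply: is_derive_eq d2 _.
  have E : `|x| `^ (alpha - 2) = x ^+ 2 * `|x| `^ (alpha - 2 - 2).
    have nx0 : `|x| != 0 by rewrite normr_eq0.
    rewrite -(real_normK (num_real x)) -powR_mulrn// -powRD ?nx0 ?implybT//.
    by congr powR; ring.
  rewrite /ddu_outer [in RHS]E /= /GRing.scale /= [in LHS]E; ring.
- move=> x1; have x2 := normr1_sqr x1.
  rewrite /du_inner /ddu_inner /du_outer /ddu_outer x1 !powR1 x2; split.
    by rewrite exprS x2; field.
  by field.
Qed.

Definition v_alpha x : R := ddu x - du x ^+ 2.

Lemma continuous_v_alpha : continuous v_alpha.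
Proof.
move=> x; apply: cvgB; last first.
  apply: (cvg_comp du (fun y => y ^+ 2)); last exact: exprn_continuous.
  apply: differentiable_continuous.
  by apply/derivable1_diffP; case: (is_derive_du x).
apply: cvg_piecewise x => [x|x x0|x x1].
- apply: cvgD; last exact: cvg_cst.
  by apply: cvgM; [exact: cvg_cst|exact: exprn_continuous].
- apply: cvgM; first exact: cvg_cst.
  have c : {for x, continuous (fun y : R => `|y| `^ (alpha - 2))}.
    apply: differentiable_continuous; apply/derivable1_diffP.
    by case: (is_derive_norm_powR (alpha - 2) x0).
  exact: c.
- have x2 := normr1_sqr x1.
  by rewrite /ddu_inner /ddu_outer x1 powR1 x2; field.
Qed.

(** This is where alpha < 2 enters: the outer second derivative
    alpha (alpha - 1) |x|^(alpha - 2) stays bounded at infinity. *)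
Lemma v_alpha_le x : 1 < alpha < 2 -> v_alpha x <= 4.
Proof.
move=> /andP[a1 a2]; rewrite /v_alpha.
suff : ddu x <= 4 by have := sqr_ge0 (du x); lra.
rewrite /ddu; case: ifPn => x1; rewrite /ddu_outer /ddu_inner.
  have h : `|x| `^ (alpha - 2) <= 1.
    rewrite -[leRHS](powRr0 `|x|); apply: (ler_powR (ltW x1)); lra.
  have := powR_ge0 `|x| (alpha - 2); nra.
have := sqr_ge0 x; nra.
Qed.

End one_dim_potential.

Lemma tnth_set_coord (R : realType) n (i j : 'I_n) (x : Rn R n) (s : R) :
  tnth (set_coord i x s) j = if j == i then s else tnth x j.
Proof. by rewrite tnth_mktuple. Qed.

Lemma partial_U_alpha (R : realType) n (alpha : R) (i : 'I_n) (x : Rn R n) :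
  partial i (U_alpha n alpha) x = du alpha (tnth x i).
Proof.
rewrite /partial derive1E.
rewrite (_ : (fun s => _) = u_alpha alpha +
    cst (\sum_(j < n | j != i) u_alpha alpha (tnth x j))); last first.
  apply/funext => s; rewrite /U_alpha (bigD1 i)//= tnth_set_coord eqxx.
  congr (_ + _); apply: eq_bigr => j /negbTE ji.
  by rewrite tnth_set_coord ji.
have := is_derive_u_alpha alpha (tnth x i) => d1.
by rewrite deriveD// derive_cst addr0 derive_val.
Qed.

Lemma partial2_U_alpha (R : realType) n (alpha : R) (i : 'I_n) (x : Rn R n) :
  partial i (partial i (U_alpha n alpha)) x = ddu alpha (tnth x i).
Proof.
have -> : partial i (partial i (U_alpha n alpha)) x =
    derive1 (du alpha) (tnth x i).
  congr (derive1 _ _); apply/funext => s.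
  by rewrite partial_U_alpha tnth_set_coord eqxx.
rewrite derive1E.
have := is_derive_du alpha (tnth x i) => d1.
by rewrite derive_val.
Qed.

Lemma laplacian_sub_grad_normsq (R : realType) n (alpha : R) (x : Rn R n) :
  laplacian (U_alpha n alpha) x - grad_normsq (U_alpha n alpha) x =
  \sum_(i < n) v_alpha alpha (tnth x i).
Proof.
rewrite /laplacian /grad_normsq -sumrB; apply: eq_bigr => i _.
by rewrite partial2_U_alpha partial_U_alpha.
Qed.

(** * Feynman-Kac expectations *)
Section feynman_kac.
Context {R : realType} {n : nat} {d : measure_display} {Omega : measurableType d}.
Local Notation mu := (@lebesgue_measure R).
Variables (v : R -> R) (C : R).
Hypotheses (cv : continuous v) (vC : forall y, v y <= C).
Variable X : R -> Omega -> Rn R n.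
Hypothesis cX : forall w (i : 'I_n),
  {within `[0, +oo[, continuous (fun t : R => tnth (X t w) i : R)}.

Definition pot (x : Rn R n) : R := \sum_(i < n) v (tnth x i).

Lemma pot_le x : pot x <= n%:R * C.
Proof.
rewrite /pot (le_trans (ler_sum _ (fun i _ => vC (tnth x i))))//.
by rewrite sumr_const card_ord mulr_natl.
Qed.

Lemma measurable_pot : measurable_fun setT pot.
Proof.
apply: measurable_sum => i; apply: (measurableT_comp (f := v)).
  exact: continuous_measurable_fun.
exact: measurable_tnth.
Qed.

Lemma continuous_pot_path w t : {within `[0, t], continuous (fun s => pot (X s w))}.
Proof.
have sub : `[0, t] `<=` `[(0 : R), +oo[ by apply: subset_itvl; rewrite bnd_simp.
apply: (continuous_subspaceW sub) => s.
rewrite /continuous_at /pot; apply: cvg_big => [|i _].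
  exact: add_continuous.
have cvXi : {within `[0, +oo[, continuous (v \o (fun t : R => tnth (X t w) i : R))}.
  apply: within_continuous_comp; last exact: (@cX w i).
  by move=> y _; exact: cv.
exact: cvXi.
Qed.

Lemma integrable_pot_path w t :
  mu.-integrable `[0, t] (EFin \o (fun s => pot (X s w))).
Proof.
apply: continuous_compact_integrable; first exact: segment_compact.
exact: continuous_pot_path.
Qed.

Definition fk_weight (t : R) (w : Omega) : R :=
  expR (2^-1 * \int[mu]_(s in `[0, t]) pot (X s w)).

Definition fk_step (dl : R) (x : Rn R n) : R := expR (2^-1 * (dl * pot x)).

(** The exponential of the Riemann sum, written as a product of one-step weights
    so that the Markov property can absorb the factors one after the other. *)
Definition fk_weight_approx (t : R) (N : nat) (w : Omega) : R :=
  \prod_(k < N.+1) fk_step (t / N.+1%:R) (X (k%:R * (t / N.+1%:R)) w).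

Lemma cvg_fk_weight t w : 0 < t ->
  fk_weight_approx t N w @[N --> \oo] --> fk_weight t w.
Proof.
move=> t0.
have := cvg_riemann_sum t0 (@continuous_pot_path w t) => rs.
rewrite (_ : (fun N => _) = (fun N => expR (2^-1 * (t / N.+1%:R *
    \sum_(k < N.+1) pot (X (k%:R * (t / N.+1%:R)) w))))); last first.
  apply/funext => N; rewrite /fk_weight_approx /fk_step -expR_sum.
  by rewrite -!mulr_sumr.
apply: (cvg_comp _ expR); last exact: continuous_expR.
by apply: cvgM; [exact: cvg_cst|exact: rs].
Qed.

Lemma fk_weight_approx_ge0 t N w : 0 <= fk_weight_approx t N w.
Proof. by apply: prodr_ge0 => k _; exact: expR_ge0. Qed.

Lemma fk_weight_approx_le t N w : 0 < t ->
  fk_weight_approx t N w <= expR (n%:R * C / 2 * t).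
Proof.
move=> t0; rewrite /fk_weight_approx /fk_step -expR_sum ler_expR.
apply: (@le_trans _ _ (\sum_(k < N.+1) (2^-1 * (t / N.+1%:R * (n%:R * C))))).
  apply: ler_sum => k _; rewrite ler_pM2l ?invr_gt0// ler_pM2l ?divr_gt0//.
  exact: pot_le.
rewrite sumr_const card_ord -[_ *+ N.+1]mulr_natr le_eqVlt; apply/orP; left; apply/eqP.
have : N.+1%:R != 0 :> R by rewrite pnatr_eq0.
by move: N.+1%:R => m m0; field.
Qed.

(** An upper bound on the potential bounds what the weight gains after
    time s. *)
Lemma fk_weightD s r w : 0 <= s -> 0 < r ->
  fk_weight (s + r) w <= expR (n%:R * C / 2 * r) * fk_weight s w.
Proof.
move=> s0 r0; rewrite /fk_weight -expRD ler_expR.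
have sr : s <= s + r by lra.
have := @Rintegral_itvB R (fun t => pot (X t w)) (BLeft 0) (BRight (s + r)) s
  (@integrable_pot_path w (s + r)).
rewrite !bnd_simp s0 => /(_ isT sr) H.
suff : \int[mu]_(x in `]s, (s + r)]) pot (X x w) <= n%:R * C * r by lra.
have cstE k : \int[mu]_(x in `]s, (s + r)]) k = k * r.
  rewrite Rintegral_cst//= lebesgue_measure_itv/= lte_fin ifT; last by lra.
  by rewrite /=; ring.
rewrite -cstE; apply: le_Rintegral => //.
- apply: (integrableS _ _ _ (@integrable_pot_path w (s + r))) => //.
  by apply: subset_itvr; rewrite bnd_simp.
- apply: (@integrableS _ _ _ mu `[s, s + r]) => //.
    by apply: subset_itvr; rewrite bnd_simp.
  apply: continuous_compact_integrable; first exact: segment_compact.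
  by apply: continuous_subspaceT => x; exact: cvg_cst.
- by move=> x _; exact: pot_le.
Qed.

Lemma fk_weight0 w : fk_weight 0 w = 1.
Proof. by rewrite /fk_weight set_itv1 Rintegral_set1 mulr0 expR0. Qed.

Lemma fk_weight_le t w : 0 < t -> fk_weight t w <= expR (n%:R * C / 2 * t).
Proof.
by move=> t0; have := fk_weightD w (lexx 0) t0; rewrite add0r fk_weight0 mulr1.
Qed.

Lemma fk_weight_ge0 t w : 0 <= fk_weight t w.
Proof. exact: expR_ge0. Qed.

Lemma measurable_fk_step dl : measurable_fun setT (fk_step dl).
Proof.
apply: (measurableT_comp (f := expR)) => //.
by apply: measurable_funM => //; apply: measurable_funM => //; exact: measurable_pot.
Qed.

Lemma past_measurable_fk_weight_approx t N : 0 < t ->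
  measurable_fun [set: pastType X t] (fk_weight_approx t N).
Proof.
move=> t0; apply: measurable_prod => k _.
apply: (measurableT_comp (measurable_fk_step _)).
apply: measurable_past; first by rewrite mulr_ge0// divr_ge0// ltW.
by rewrite mulrCA ler_piMr ?(ltW t0)// ler_pdivrMr// mul1r ler_nat ltnW.
Qed.

(** The integral over [0, t] is a limit of Riemann sums taken at times before
    t. *)
Lemma past_measurable_fk_weight t : 0 < t ->
  measurable_fun [set: pastType X t] (fk_weight t).
Proof.
move=> t0.
apply: (@measurable_fun_cvg _ (pastType X t) R setT (fk_weight_approx t)).
  by move=> N; exact: past_measurable_fk_weight_approx.
by move=> w _; exact: cvg_fk_weight.
Qed.

End feynman_kac.

Section expectations.
Context {R : realType} {n : nat} {d : measure_display} {Omega : measurableType d}.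
Variable v : R -> R.
Hypothesis cv : continuous v.
Variable X : R -> Omega -> Rn R n.

Lemma bm_expect_start (P : probability Omega R) x (g : Rn R n -> \bar R) :
  brownian_motion P X x -> measurable_fun setT g -> (forall y, 0 <= g y)%E ->
  (\int[P]_w g (X 0 w) = g x)%E.
Proof.
move=> bm mg g0; have mX0 := bm_measurable bm (lexx 0).
have mx : measurable (X 0 @^-1` [set x]).
  rewrite (_ : [set x] = box (fun i => [set tnth x i])); last first.
    apply/seteqP; split => [_ -> //|y yx]; apply: eq_from_tnth => i.
    exact: yx.
  rewrite -[X in measurable X]setTI; apply: mX0 => //.
  by apply: measurable_box.
transitivity (\int[P]_w (cst (g x) w))%E; last first.
  by rewrite integral_cst//= probability_setT mule1.
apply: ge0_ae_eq_integral => //.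
- exact: (measurableT_comp mg mX0).
- by move=> w _; exact: g0.
- exists (~` (X 0 @^-1` [set x])); split.
  + exact: measurableC.
  + have := probability_setC P mx.
    by rewrite (bm_start bm) subee.
  + by move=> w /= h h'; apply: h => _; rewrite h'.
Qed.

(** One step of the discretized semigroup: let the heat flow run for a time dl,
    then multiply by the weight at the starting point. *)
Definition fk_kernel (dl : R) (g : Rn R n -> \bar R) (y : Rn R n) : \bar R :=
  ((fk_step v dl y)%:E * heat (Num.sqrt dl) g y)%E.

Lemma fk_kernel_ge0 dl g y : (forall y, 0 <= g y)%E -> (0 <= fk_kernel dl g y)%E.
Proof.
by move=> g0; rewrite mule_ge0 ?heat_ge0// lee_fin expR_ge0.
Qed.

Lemma measurable_fk_kernel dl g : measurable_fun setT g -> (forall y, 0 <= g y)%E ->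
  measurable_fun setT (fk_kernel dl g).
Proof.
move=> mg g0; apply: emeasurable_funM; last exact: measurable_heat.
by apply/measurable_EFinP; exact: measurable_fk_step.
Qed.

Lemma measurable_iter_fk_kernel dl g k :
  measurable_fun setT g -> (forall y, 0 <= g y)%E ->
  measurable_fun setT (iter k (fk_kernel dl) g).
Proof.
move=> mg g0; suff [] : measurable_fun setT (iter k (fk_kernel dl) g) /\
    (forall y, 0 <= iter k (fk_kernel dl) g y)%E by [].
elim: k => [//|k [mk k0]]; split => [|y] /=; first exact: measurable_fk_kernel.
exact: fk_kernel_ge0.
Qed.

(** By induction on the number of steps, the Markov property replaces the last
    transition by the heat kernel. The right-hand side mentions neither P nor
    X: this is what makes expectations measurable in the starting point. *)
Lemma expect_chain (P : probability Omega R) x (dl : R) k (g : Rn R n -> \bar R) :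
  brownian_motion P X x -> 0 < dl ->
  measurable_fun setT g -> (forall y, 0 <= g y)%E ->
  (\int[P]_w ((\prod_(j < k) fk_step v dl (X (j%:R * dl) w))%:E * g (X (k%:R * dl) w))
   = iter k (fk_kernel dl) g x)%E.
Proof.
move=> bm dl0; elim: k g => [|k IH] g mg g0.
  under eq_integral do rewrite big_ord0 mul1e mul0r.
  exact: bm_expect_start.
have k0 : 0 <= k%:R * dl by rewrite mulr_ge0// ltW.
have kk : k%:R * dl < k.+1%:R * dl by rewrite ltr_pM2r// ltr_nat.
rewrite (@markov _ _ _ _ X P x (k%:R * dl) _
  (fun w => \prod_(j < k.+1) fk_step v dl (X (j%:R * dl) w)) g)//; last 2 first.
- apply: measurable_prod => j _; apply: (measurableT_comp (measurable_fk_step cv _)).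
  apply: measurable_past; first by rewrite mulr_ge0// ltW.
  by rewrite ler_pM2r// ler_nat -ltnS.
- by move=> w; apply: prodr_ge0 => j _; exact: expR_ge0.
rewrite (_ : k.+1%:R * dl - k%:R * dl = dl); last by rewrite -natr1; ring.
rewrite iterSr -IH; last 2 first.
- exact: measurable_fk_kernel.
- by move=> y; exact: fk_kernel_ge0.
by apply: eq_integral => w _; rewrite big_ord_recr/= EFinM muleA.
Qed.

End expectations.

Section expectation_bounds.
Context {R : realType} {n : nat} {d : measure_display} {Omega : measurableType d}.
Variables (v : R -> R) (C : R).
Hypotheses (cv : continuous v) (vC : forall y, v y <= C).
Variables (P : Rn R n -> probability Omega R) (X : R -> Omega -> Rn R n).
Hypothesis hX : forall x, brownian_motion (P x) X x.

Definition fk_expect (t : R) (f : Rn R n -> R) (x : Rn R n) : \bar R :=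
  (\int[P x]_w (f (X t w) * fk_weight v X t w)%:E)%E.

Let cX w (i : 'I_n) : {within `[0, +oo[, continuous (fun t : R => tnth (X t w) i : R)}.
Proof. exact: (bm_continuous (hX [tuple 0 | _ < n])). Qed.

Let mX t : 0 <= t -> measurable_fun setT (X t).
Proof. exact: (bm_measurable (hX [tuple 0 | _ < n])). Qed.

Lemma measurable_fk_weight t : 0 < t -> measurable_fun setT (fk_weight v X t).
Proof.
move=> t0; apply: (past_sub_measurable mX (s := t)).
exact: past_measurable_fk_weight.
Qed.

Lemma measurable_fk_integrand t (f : Rn R n -> R) : 0 < t -> measurable_fun setT f ->
  measurable_fun setT (fun w => f (X t w) * fk_weight v X t w).
Proof.
move=> t0 mf; apply: measurable_funM; last exact: measurable_fk_weight.
exact: (measurableT_comp mf (mX (ltW t0))).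
Qed.

(** Boundedness of f provides the constant that dominates the approximations of
    the weight. *)
Lemma measurable_fk_expect_bounded t (f : Rn R n -> R) (B : R) :
  0 < t -> measurable_fun setT f ->
  (forall y, 0 <= f y <= B) -> measurable_fun setT (fk_expect t f).
Proof.
move=> t0 mf fB.
have f0 y : 0 <= f y by have /andP[] := fB y.
have mEf : measurable_fun setT (EFin \o f) by exact/measurable_EFinP.
pose h N x := (\int[P x]_w (fk_weight_approx v X t N w * f (X t w))%:E)%E.
have Ndl N : N.+1%:R * (t / N.+1%:R) = t by rewrite mulrCA divff ?mulr1// pnatr_eq0.
apply: (emeasurable_fun_cvg h) => [N|x _].
  rewrite (_ : h N = iter N.+1 (fk_kernel v (t / N.+1%:R)) (EFin \o f)).
    by apply: measurable_iter_fk_kernel => // y; rewrite lee_fin.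
  apply/funext => x; rewrite -(expect_chain cv N.+1 (hX x))//.
  - by apply: eq_integral => w _; rewrite Ndl -EFinM.
  - by rewrite divr_gt0.
pose b := expR (n%:R * C / 2 * t) * B.
have ib : (P x).-integrable setT (EFin \o cst b).
  exact: finite_measure_integrable_cst.
have mfX : measurable_fun setT (f \o X t).
  exact: (measurableT_comp mf (mX (ltW t0))).
have [] := @dominated_convergence _ _ _ (P x) setT measurableT
   (fun N w => (fk_weight_approx v X t N w * f (X t w))%:E)
   (fun w => (f (X t w) * fk_weight v X t w)%:E) (EFin \o cst b) => //.
- move=> N; apply/measurable_EFinP; apply: measurable_funM => //.
  apply: (past_sub_measurable mX (s := t)).
  exact: past_measurable_fk_weight_approx.
- by apply/measurable_EFinP; exact: measurable_fk_integrand.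
- apply: aeW => w _; apply/cvg_EFin; first by near=> N.
  rewrite /= mulrC; apply: cvgM; last exact: cvg_cst.
  exact: cvg_fk_weight.
- apply: aeW => w N _; rewrite /= lee_fin ger0_norm; last first.
    by rewrite mulr_ge0// fk_weight_approx_ge0.
  rewrite ler_pM// ?fk_weight_approx_ge0//; first exact: fk_weight_approx_le.
  by have /andP[] := fB (X t w).
Unshelve. all: by end_near. Qed.

(** Truncation at height m reduces to bounded functions. *)
Lemma measurable_fk_expect t (f : Rn R n -> R) : 0 < t -> measurable_fun setT f ->
  (forall y, 0 <= f y) -> measurable_fun setT (fk_expect t f).
Proof.
move=> t0 mf f0.
pose g m y := Num.min (f y) m%:R.
have mg m : measurable_fun setT (g m).
  by apply: measurable_minr => //; exact: measurable_cst.
have g0 m y : 0 <= g m y by rewrite le_min f0 ler0n.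
apply: (emeasurable_fun_cvg (fun m => fk_expect t (g m))) => [m|x _].
  apply: (@measurable_fk_expect_bounded _ _ m%:R) => // y.
  by rewrite g0/= ge_min lexx orbT.
have gf w : (g m (X t w) * fk_weight v X t w)%:E @[m --> \oo] -->
    (f (X t w) * fk_weight v X t w)%:E.
  apply: cvg_near_cst; near=> m; congr (_ * _)%:E; apply/min_idPl.
  by near: m; exact: nbhs_infty_ger.
rewrite /fk_expect.
under eq_integral => w _ do rewrite -(cvg_lim (@ereal_hausdorff R) (gf w)).
apply: cvg_monotone_convergence => //.
- by move=> m; apply/measurable_EFinP; exact: measurable_fk_integrand.
- by move=> m w _; rewrite lee_fin mulr_ge0// fk_weight_ge0.
- move=> w _ m m' mm'; rewrite lee_fin ler_wpM2r ?fk_weight_ge0//.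
  by rewrite le_min ge_min lexx/= ge_min ler_nat mm' orbT.
Unshelve. all: by end_near. Qed.

Lemma fk_expect1_lty t x : 0 < t -> (fk_expect t (cst 1%R) x < +oo)%E.
Proof.
move=> t0; apply: (@le_lt_trans _ _ (\int[P x]_w (expR (n%:R * C / 2 * t))%:E)%E).
  apply: ge0_le_integral => //.
  - by move=> w _; rewrite lee_fin mul1r fk_weight_ge0.
  - by apply/measurable_EFinP; exact: measurable_fk_integrand.
  - by move=> w _; rewrite lee_fin mul1r; exact: fk_weight_le.
by rewrite integral_cst//= probability_setT mule1 ltry.
Qed.

(** Freeze the weight at time t, then condition on the past up to time t: the
    heat flow run from X_t for a further time t is bounded by the L^2 norm. *)
Lemma fk_expect_le t : 0 < t -> exists2 K : R, 0 < K &
  forall (f : Rn R n -> R) (N : R) x, measurable_fun setT f -> (forall y, 0 <= f y) -> 0 < N ->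
  (\int[lebesgueRn n]_y (f y ^+ 2)%:E <= (N ^+ 2)%:E)%E ->
  (fk_expect (t + t) f x <= (K * N)%:E * fk_expect t (cst 1%R) x)%E.
Proof.
move=> t0.
have st0 : Num.sqrt t != 0 :> R by rewrite gt_eqF// sqrtr_gt0.
have [K K0 heatK] := heat_le_L2 n st0.
set e := expR (n%:R * C / 2 * t).
exists (e * K) => [|f N x mf f0 N0 fN]; first by rewrite mulr_gt0// expR_gt0.
have mEf : measurable_fun setT (EFin \o f) by exact/measurable_EFinP.
have tt : t < t + t by lra.
have tt0 : 0 < t + t by lra.
have mW := measurable_fk_weight t0.
have mfX : measurable_fun setT (f \o X (t + t)).
  exact: (measurableT_comp mf (mX (ltW tt0))).
apply: (@le_trans _ _ (\int[P x]_w
    (e%:E * ((fk_weight v X t w)%:E * (f (X (t + t) w))%:E)))%E).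
  apply: ge0_le_integral => //.
  - by move=> w _; rewrite lee_fin mulr_ge0// fk_weight_ge0.
  - by apply/measurable_EFinP; exact: measurable_fk_integrand.
  - apply/measurable_EFinP; apply: measurable_funM => //.
    exact: measurable_funM.
  - move=> w _; rewrite -!EFinM lee_fin mulrA [leRHS]mulrC ler_wpM2l//.
    by apply: fk_weightD => //; exact: ltW.
rewrite ge0_integralZl//; first last.
- by rewrite lee_fin expR_ge0.
- by move=> w _; rewrite mule_ge0 ?lee_fin ?fk_weight_ge0.
- by apply/measurable_EFinP; exact: measurable_funM.
rewrite -mulrA EFinM -muleA lee_wpmul2l ?lee_fin ?expR_ge0//.
rewrite (@markov _ _ _ _ X (P x) x t (t + t) (fk_weight v X t) (EFin \o f))//; last 3 first.
- exact: ltW.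
- exact: past_measurable_fk_weight.
- by move=> w; exact: fk_weight_ge0.
rewrite (_ : t + t - t = t); last by ring.
rewrite /fk_expect -ge0_integralZl//; first last.
- by rewrite lee_fin mulr_ge0// ltW.
- by move=> w _; rewrite lee_fin mulr_ge0// fk_weight_ge0.
- by apply/measurable_EFinP; exact: measurable_fk_integrand.
apply: ge0_le_integral => //.
- by move=> w _; rewrite mule_ge0 ?lee_fin ?fk_weight_ge0//; exact: heat_ge0.
- apply: emeasurable_funM; first exact/measurable_EFinP.
  have mh : measurable_fun setT (heat (Num.sqrt t) (EFin \o f)).
    by apply: measurable_heat => // y; rewrite lee_fin.
  exact: (measurableT_comp mh (mX (ltW t0))).
- apply: emeasurable_funM => //.
  by apply/measurable_EFinP; exact: measurable_fk_integrand.
- move=> w _; rewrite mul1r [leRHS]muleC lee_wpmul2l ?lee_fin ?fk_weight_ge0//.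
  exact: heatK.
Qed.

End expectation_bounds.

(** * Domination in an Orlicz class *)
Section orlicz_domination.
Context {R : realType}.
Variables (tau psi : R -> R).
Hypotheses (htau : young_function tau)
  (htaupsi : forall y : R, 0 < y -> tau y = y ^+ 2 * psi y)
  (hpsi_pos : forall y : R, 0 < y -> 0 < psi y)
  (hpsi_ndecr : forall y z : R, 0 < y -> y <= z -> psi y <= psi z)
  (hpsi_doubling : exists k : R, forall y : R, 0 < y -> psi (2 * y) <= k * psi y).

Let tau0 : tau 0 = 0. Proof. by case: htau. Qed.

Lemma young_norm y : tau `|y| = tau y.
Proof.
case: htau => _ even _ _; have [y0|y0] := leP 0 y; first by rewrite ger0_norm.
by rewrite ltr0_norm// even.
Qed.

Lemma young_ge0 y : 0 <= tau y.
Proof.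
rewrite -young_norm; have [->|y0] := eqVneq `|y| 0; first by rewrite tau0.
have yp : 0 < `|y| by rewrite lt0r y0/=.
by rewrite htaupsi// mulr_ge0 ?sqr_ge0// ltW// hpsi_pos.
Qed.

Lemma le_young y z : `|y| <= z -> tau y <= tau z.
Proof.
move=> yz; rewrite -young_norm; have [->|y0] := eqVneq `|y| 0.
  by rewrite tau0 young_ge0.
have yp : 0 < `|y| by rewrite lt0r y0/=.
have zp : 0 < z by exact: lt_le_trans yz.
rewrite !htaupsi// ler_pM ?sqr_ge0//; first by rewrite ltW// hpsi_pos.
- by rewrite ler_sqr ?nnegrE// ltW.
- exact: hpsi_ndecr.
Qed.

(** Doubling: tau(2 y) = 4 y^2 psi(2 y) <= 4 k tau(y), then iterate until 2^m
    exceeds |a|. *)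
Lemma young_scale_le (a : R) :
  exists2 c : R, 0 <= c & forall y, 0 <= y -> tau (a * y) <= c * tau y.
Proof.
have [k psik] := hpsi_doubling.
have k0 : 0 <= k.
  have := psik 1 ltr01; rewrite mulr1.
  have p1 := hpsi_pos (@ltr01 R); have p2 : 0 < psi 2 by exact: hpsi_pos.
  by move=> h; nra.
have dbl j y : 0 <= y -> tau (2 ^+ j * y) <= (4 * k) ^+ j * tau y.
  move=> y0; elim: j => [|j IH]; first by rewrite !expr0 !mul1r.
  have [->|yn0] := eqVneq y 0; first by rewrite !mulr0 tau0 mulr0.
  have y_gt0 : 0 < y by rewrite lt0r yn0.
  have yp : 0 < 2 ^+ j * y by rewrite mulr_gt0 ?exprn_gt0.
  apply: (@le_trans _ _ (4 * k * tau (2 ^+ j * y))); last first.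
    by rewrite [in leRHS]exprS -[leRHS]mulrA ler_wpM2l// mulr_ge0.
  rewrite exprS -mulrA !htaupsi ?mulr_gt0//.
  rewrite (_ : (2 * _) ^+ 2 * _ = 4 * (2 ^+ j * y) ^+ 2 * psi (2 * (2 ^+ j * y)));
    last by ring.
  rewrite (_ : 4 * k * _ = 4 * (2 ^+ j * y) ^+ 2 * (k * psi (2 ^+ j * y)));
    last by ring.
  by rewrite ler_wpM2l ?psik// mulr_ge0// sqr_ge0.
pose m := Num.bound `|a|.
exists ((4 * k) ^+ m) => [|y y0]; first by rewrite exprn_ge0// mulr_ge0.
apply: le_trans (dbl m y y0); apply: le_young.
rewrite normrM (ger0_norm y0) ler_wpM2r//.
have am : `|a| < m%:R by apply: archi_boundP.
rewrite (le_trans (ltW am))// -natrX ler_nat; exact/ltnW/ltn_expl.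
Qed.

Lemma young_div_le (k y : R) : 1 <= k -> 0 <= y -> tau (k^-1 * y) <= k^-1 * tau y.
Proof.
move=> k1 y0; have [->|yn0] := eqVneq y 0; first by rewrite mulr0 tau0 mulr0.
have yp : 0 < y by rewrite lt0r yn0.
have kp : 0 < k by exact: lt_le_trans k1.
have kV1 : k^-1 <= 1 by rewrite invf_le1.
have kVp : 0 < k^-1 by rewrite invr_gt0.
have kyp : 0 < k^-1 * y by exact: mulr_gt0.
have ky : k^-1 * y <= y by rewrite ler_piMl.
rewrite !htaupsi// mulrA ler_pM//.
- exact: sqr_ge0.
- by rewrite ltW// hpsi_pos.
- by rewrite exprMn ler_wpM2r ?sqr_ge0// expr2 ler_piMl// ltW.
- exact: hpsi_ndecr.
Qed.

Lemma young1_gt0 : 0 < tau 1.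
Proof. by rewrite htaupsi// expr1n mul1r hpsi_pos. Qed.

Context {d : measure_display} {T : measurableType d}.
Variable mu : {measure set T -> \bar R}.

Lemma measurable_young (f : T -> R) : measurable_fun setT f ->
  measurable_fun setT (fun x => (tau (f x))%:E).
Proof.
move=> mf; apply/measurable_EFinP; apply: (measurableT_comp _ mf).
by apply: continuous_measurable_fun; case: htau.
Qed.

Lemma Lfun2_sqr_bound (h : T -> R) : h \in Lfun mu 2%:E ->
  exists2 N : R, 0 < N & (\int[mu]_y (h y ^+ 2)%:E <= (N ^+ 2)%:E)%E.
Proof.
move=> hL2; have mh : measurable_fun setT h.
  by move: hL2; rewrite inE => /andP[]; rewrite inE.
have /integrableP[_ h2oo] := Lfun2_integrable_sqr hL2.
have h2E : (\int[mu]_y (h y ^+ 2)%:E < +oo)%E.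
  apply: le_lt_trans h2oo; apply: ge0_le_integral => //.
  - by move=> x _; rewrite lee_fin sqr_ge0.
  - by apply/measurable_EFinP; exact: measurable_funX.
  - apply: measurableT_comp => //.
    by apply/measurable_EFinP; exact: measurable_funX.
  - by move=> x _; rewrite lee_abs.
set I := (\int[mu]_y (h y ^+ 2)%:E)%E in h2E *.
have I0 : (0 <= I)%E by apply: integral_ge0 => x _; rewrite lee_fin sqr_ge0.
have fI0 : 0 <= fine I by exact: fine_ge0.
exists (1 + fine I); first lra.
rewrite -[leLHS]fineK ?ge0_fin_numE// lee_fin; nra.
Qed.

(** If |S_s h| <= K N F whenever the L^2 norm of h is at most N, and F is in the
    Orlicz class, then S_s h is in the class by young_scale_le. For continuity,
    pick k with int tau(F / k) <= tau(1): a perturbation of L^2 norm at most dl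
    moves S_s h by at most K dl F, hence by at most K dl k in gauge norm. *)
Lemma hyperbounded_of_domination (S : R -> (T -> R) -> T -> \bar R) (s K : R)
    (F : T -> R) :
  0 < s -> 0 < K -> measurable_fun setT F -> (forall x, 0 <= F x) ->
  (\int[mu]_x (tau (F x))%:E < +oo)%E ->
  (forall h, measurable_fun setT h -> measurable_fun setT (S s h)) ->
  (forall (h : T -> R) (N : R) x, measurable_fun setT h -> 0 < N ->
    (\int[mu]_y (h y ^+ 2)%:E <= (N ^+ 2)%:E)%E ->
    (`|S s h x| <= (K * N * F x)%:E)%E) ->
  (forall (g h : T -> R) x, g \in Lfun mu 2%:E -> h \in Lfun mu 2%:E ->
    (S s g x - S s h x = S s (g \- h)%R x)%E) ->
  orlicz_hyperbounded mu tau S.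
Proof.
move=> s0 K0 mF F0 tauF mS domS linS; exists s; split => //.
have mLfun h : h \in Lfun mu 2%:E -> measurable_fun setT h.
  by rewrite inE => /andP[]; rewrite inE.
split=> [h hL2|h hL2 eps eps0].
  have mh := mLfun h hL2; split; first exact: mS.
  have [N N0 IN] := Lfun2_sqr_bound hL2.
  have [c c0 tauc] := young_scale_le (K * N).
  apply: (@le_lt_trans _ _ (\int[mu]_x (c%:E * (tau (F x))%:E))%E); last first.
    rewrite ge0_integralZl//; last 2 first.
    - exact: measurable_young.
    - by move=> x _; rewrite lee_fin young_ge0.
    - by apply: lte_mul_pinfty => //; rewrite lee_fin.
  have SE x : S s h x = (fine (S s h x))%:E.
    rewrite fineK// fin_num_abs; apply: le_lt_trans (domS h N x mh N0 IN) _.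
    exact: ltry.
  have mfS : measurable_fun setT (fun x => fine (S s h x)).
    exact: measurableT_comp (mS _ mh).
  under eq_integral => x _ do rewrite SE /=.
  apply: ge0_le_integral => //.
  - by move=> x _; rewrite lee_fin young_ge0.
  - exact: measurable_young.
  - by apply: emeasurable_funM => //; exact: measurable_young.
  - move=> x _; rewrite -EFinM lee_fin; apply: le_trans (tauc _ (F0 x)).
    apply: le_young; have := domS h N x mh N0 IN.
    by rewrite SE/= lee_fin.
have tau1 := young1_gt0.
set J := (\int[mu]_x (tau (F x))%:E)%E in tauF.
have J0 : (0 <= J)%E by apply: integral_ge0 => x _; rewrite lee_fin young_ge0.
have fJ0 : 0 <= fine J by exact: fine_ge0.
pose k := 1 + fine J / tau 1.
have k1 : 1 <= k by rewrite /k lerDl divr_ge0// ltW.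
have kp : 0 < k by exact: lt_le_trans k1.
have kV0 : 0 <= k^-1 by rewrite invr_ge0 ltW.
have tauFk : (\int[mu]_x (tau (k^-1 * F x))%:E <= (tau 1)%:E)%E.
  apply: (@le_trans _ _ (\int[mu]_x (k^-1%:E * (tau (F x))%:E))%E).
    apply: ge0_le_integral => //.
    - by move=> x _; rewrite lee_fin young_ge0.
    - by apply: measurable_young; exact: measurable_funM.
    - by apply: emeasurable_funM => //; exact: measurable_young.
    - by move=> x _; rewrite -EFinM lee_fin young_div_le.
  rewrite ge0_integralZl//; last 2 first.
  - exact: measurable_young.
  - by move=> x _; rewrite lee_fin young_ge0.
  rewrite -/J -(fineK (_ : J \is a fin_num)) ?ge0_fin_numE//.
  rewrite -EFinM lee_fin ler_pdivrMl// /k mulrDl mul1r divfK ?gt_eqF//.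
  by rewrite lerDr ltW.
(* so that K * dl * k = eps / 2 *)
pose dl := eps / (2 * K * k).
have dl0 : 0 < dl by rewrite divr_gt0// !mulr_gt0.
exists dl; split => // g gL2 ghdl.
have mg := mLfun g gL2; have mh := mLfun h hL2.
pose f : T -> R := g \- h.
have mgh : measurable_fun setT f by exact: measurable_funB.
have gh2 : (\int[mu]_y ((f y) ^+ 2)%:E <= (dl ^+ 2)%:E)%E.
  have -> : (\int[mu]_y ((f y) ^+ 2)%:E =
      \int[mu]_y (`|(EFin \o f) y| `^ 2))%E.
    apply: eq_integral => y _ /=.
    by rewrite powR_mulrn// real_normK// num_real.
  rewrite -poweR_Lnorm ?pnatr_eq0//.
  have -> : ((dl ^+ 2)%:E = dl%:E `^ 2)%E by rewrite poweR_EFin powR_mulrn// ltW.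
  apply: gt0_ler_poweR => //.
  - by rewrite in_itv/= leey Lnorm_ge0.
  - by rewrite in_itv/= leey lee_fin ltW.
  - exact: ltW.
apply: (@le_lt_trans _ _ (eps / 2)%:E); last by rewrite lte_fin; lra.
apply: ereal_inf_lbound; exists (eps / 2) => //; split; first by lra.
have DE x : (S s g x - S s h x = (fine (S s f x))%:E)%E.
  rewrite linS// fineK// fin_num_abs.
  by apply: le_lt_trans (domS _ dl x mgh dl0 gh2) _; exact: ltry.
apply: le_trans tauFk.
under eq_integral => x _ do rewrite DE /=.
apply: ge0_le_integral => //.
- by move=> x _; rewrite lee_fin young_ge0.
- apply: measurable_young; apply: measurable_funM => //.
  exact: measurableT_comp (mS _ mgh).
- by apply: measurable_young; exact: measurable_funM.
- move=> x _; rewrite lee_fin; apply: le_young.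
  have : `|fine (S s f x)| <= K * dl * F x.
    have fE : S s f x = (fine (S s f x))%:E by rewrite -DE linS.
    by have := domS _ dl x mgh dl0 gh2; rewrite fE lee_fin.
  rewrite normrM ger0_norm ?invr_ge0; last by lra.
  move=> D; rewrite ler_pdivrMl; last by lra.
  apply: le_trans D _; rewrite le_eqVlt; apply/orP; left; apply/eqP.
  by rewrite /dl; field; rewrite !gt_eqF.
Qed.

End orlicz_domination.

(** * The semigroup of the potential *)
Section semigroup_bounds.
Context {R : realType} {n : nat} {d : measure_display} {Omega : measurableType d}.
Variables (alpha : R) (halpha : 1 < alpha < 2).
Variables (P : Rn R n -> probability Omega R) (X : R -> Omega -> Rn R n).
Hypothesis hX : forall x, brownian_motion (P x) X x.
Local Notation U := (U_alpha n alpha).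
Local Notation v := (v_alpha alpha).
Local Notation FK := (fk_expect v P X).

Let cv : continuous v. Proof. exact: continuous_v_alpha. Qed.
Let vC y : v y <= 4. Proof. exact: v_alpha_le. Qed.

(** Multiplication by the ground state e^(-U) maps L^2(nu) to L^2(dx), with
    int (h e^(-U))^2 dx = Z int h^2 dnu. *)
Definition ground_transform (h : Rn R n -> R) (y : Rn R n) : R := h y * expR (- U y).

Lemma measurable_ground h : measurable_fun setT h -> measurable_fun setT (ground_transform h).
Proof.
move=> mh; apply: measurable_funM => //; apply: measurableT_comp => //.
by apply: measurable_funN; exact: measurable_U_alpha.
Qed.

Lemma M_alphaE t w : M_alpha alpha X t w = fk_weight v X t w.
Proof.
rewrite /M_alpha /fk_weight; congr (expR (_ * _)).
by apply: eq_Rintegral => s _; exact: laplacian_sub_grad_normsq.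
Qed.

Lemma P_alphaE t h x :
  P_alpha alpha P X t h x = ((expR (U x))%:E * FK t (ground_transform h) x)%E.
Proof.
rewrite /P_alpha expectation.unlock /fk_expect.
by under eq_integral do rewrite M_alphaE.
Qed.

Lemma P_alpha_expU t x :
  P_alpha alpha P X t (fun x => expR (U x)) x = ((expR (U x))%:E * FK t (cst 1%R) x)%E.
Proof.
rewrite P_alphaE; congr (_ * FK t _ x)%E; apply/funext => y.
by rewrite /ground_transform -expRD subrr expR0.
Qed.

Definition pos_part (f : Rn R n -> R) (y : Rn R n) : R := Num.max (f y) 0.

(** The weight is nonnegative, so positive and negative parts can be taken
    before weighting; the integral of a signed function is by definition this
    difference. *)
Lemma fk_expect_posneg t (f : Rn R n -> R) x : 0 < t -> measurable_fun setT f ->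
  (FK t f x = FK t (pos_part f) x - FK t (pos_part (\- f)%R) x)%E.
Proof.
move=> t0 mf; rewrite /fk_expect integralE; congr (_ - _)%E.
- apply: eq_integral => w _; rewrite funeposE.
  rewrite -EFin_max; congr (_%:E).
  by rewrite maxr_pMl ?fk_weight_ge0// mul0r.
- apply: eq_integral => w _; rewrite funenegE.
  rewrite -EFinN -EFin_max; congr (_%:E).
  by rewrite maxr_pMl ?fk_weight_ge0// mul0r mulNr.
Qed.

Lemma measurable_fk_expect_signed t (f : Rn R n -> R) : 0 < t -> measurable_fun setT f ->
  measurable_fun setT (FK t f).
Proof.
move=> t0 mf.
rewrite (_ : FK t f =
    (fun x => FK t (pos_part f) x - FK t (pos_part (\- f)%R) x)%E); last first.
  by apply/funext => x; exact: fk_expect_posneg.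
apply: emeasurable_funB; apply: (measurable_fk_expect cv vC hX t0).
- by apply: measurable_maxr => //; exact: measurable_cst.
- by move=> y; rewrite le_max lexx orbT.
- apply: measurable_maxr; last exact: measurable_cst.
  exact: measurable_funN.
- by move=> y; rewrite le_max lexx orbT.
Qed.

Lemma measurable_P_alpha t h : 0 < t -> measurable_fun setT h ->
  measurable_fun setT (P_alpha alpha P X t h).
Proof.
move=> t0 mh; rewrite (_ : P_alpha _ _ _ _ _ =
    (fun x => (expR (U x))%:E * FK t (ground_transform h) x)%E); last first.
  by apply/funext => x; exact: P_alphaE.
apply: emeasurable_funM.
  apply/measurable_EFinP; apply: measurableT_comp => //.
  exact: measurable_U_alpha.
by apply: measurable_fk_expect_signed => //; exact: measurable_ground.
Qed.

(** The normalizing constant is the real number attached to an extended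
    integral, and a divergent integral would give 0. In that case nu_alpha is
    the zero measure, for which hyperboundedness reduces to measurability;
    treating it apart replaces the proof that the integral converges. *)
Lemma nu_alpha_degenerate : ~ 0 < Z_alpha n alpha ->
  forall f : Rn R n -> \bar R, (\int[nu_alpha n alpha]_x f x = 0)%E.
Proof.
move=> Z0 f.
have Z_ge0 : 0 <= Z_alpha n alpha.
  by apply: Rintegral_ge0 => x _; exact: expR_ge0.
have ZE : Z_alpha n alpha = 0 by apply/eqP; rewrite eq_le Z_ge0 andbT leNgt; apply/negP.
rewrite (eq_measure_integral mzero) ?integral_measure_zero// => A mA _.
rewrite /nu_alpha /= /nu_alpha ZE invr0; under eq_integral do rewrite mul0r.
exact: integral0.
Qed.

Lemma integral_nu_alpha (g : Rn R n -> \bar R) :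
  measurable_fun setT g -> (forall x, 0 <= g x)%E ->
  (\int[nu_alpha n alpha]_x g x =
   \int[lebesgueRn n]_x (g x * ((Z_alpha n alpha)^-1 * expR (- 2 * U x))%:E))%E.
Proof.
move=> mg g0.
apply: (@ge0_integral_density _ _ _ (lebesgueRn n) (nu_alpha n alpha)
  (fun x => (Z_alpha n alpha)^-1 * expR (- 2 * U x))) => //.
- apply: measurable_funM => //; apply: measurableT_comp => //.
  by apply: measurable_funM => //; exact: measurable_U_alpha.
- move=> x; rewrite mulr_ge0 ?expR_ge0// invr_ge0.
  by apply: Rintegral_ge0 => y _; exact: expR_ge0.
Qed.

Lemma integral_sqr_ground (h : Rn R n -> R) : 0 < Z_alpha n alpha ->
  measurable_fun setT h ->
  (\int[lebesgueRn n]_y (ground_transform h y ^+ 2)%:E =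
   (Z_alpha n alpha)%:E * \int[nu_alpha n alpha]_y (h y ^+ 2)%:E)%E.
Proof.
move=> Z0 mh.
have mh2 : measurable_fun setT (fun y => (h y ^+ 2)%:E).
  by apply/measurable_EFinP; exact: measurable_funX.
rewrite integral_nu_alpha//; last by move=> y; rewrite lee_fin sqr_ge0.
rewrite -ge0_integralZl//; last 3 first.
- apply: emeasurable_funM => //; apply/measurable_EFinP.
  apply: measurable_funM => //; apply: measurableT_comp => //.
  by apply: measurable_funM => //; exact: measurable_U_alpha.
- move=> x _; rewrite mule_ge0// lee_fin ?sqr_ge0// mulr_ge0 ?expR_ge0//.
  by rewrite invr_ge0 ltW.
- by rewrite lee_fin ltW.
apply: eq_integral => y _; rewrite -!EFinM; congr (_%:E).
rewrite /ground_transform exprMn (_ : expR (- 2 * U y) = expR (- U y) ^+ 2); last first.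
  by rewrite -expRM_natl mulrN mulNr.
by field; rewrite gt_eqF.
Qed.

(** The bound is stated for the expectation of the absolute value, which also
    provides the integrability needed for the linearity of the semigroup. *)
Lemma P_alpha_dominated t : 0 < t -> 0 < Z_alpha n alpha ->
  exists2 K : R, 0 < K & forall (h : Rn R n -> R) (N : R) x,
    measurable_fun setT h -> 0 < N ->
    (\int[nu_alpha n alpha]_y (h y ^+ 2)%:E <= (N ^+ 2)%:E)%E ->
    (\int[P x]_w `|(ground_transform h (X (t + t) w) * fk_weight v X (t + t) w)%:E|
      <= (K * N)%:E * FK t (cst 1%R) x)%E.
Proof.
move=> t0 Z0; have [K K0 domK] := fk_expect_le cv vC hX t0.
have sZ0 : 0 < Num.sqrt (Z_alpha n alpha) by rewrite sqrtr_gt0.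
exists (K * Num.sqrt (Z_alpha n alpha)) => [|h N x mh N0 hN]; first exact: mulr_gt0.
have mg := measurable_ground mh.
rewrite -mulrA; apply: le_trans (domK (fun y => `|ground_transform h y|) _ x _ _ _ _).
- apply: ge0_le_integral => //.
  + apply: measurableT_comp => //; apply/measurable_EFinP.
    by apply: (measurable_fk_integrand cv hX) => //; lra.
  + apply/measurable_EFinP.
    apply: (measurable_fk_integrand cv hX (f := fun y => `|ground_transform h y|)).
      by lra.
    exact: measurableT_comp.
  + by move=> w _ /=; rewrite normrM (ger0_norm (fk_weight_ge0 _ _ _ _)).
- exact: measurableT_comp.
- by move=> y.
- exact: mulr_gt0.
- under eq_integral do rewrite real_normK ?num_real//.
  rewrite integral_sqr_ground// exprMn sqr_sqrtr ?(ltW Z0)// EFinM.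
  by rewrite lee_wpmul2l// lee_fin ltW.
Qed.

End semigroup_bounds.

Theorem theorem2 (R : realType) (alpha : R) (n : nat)
    (halpha : 1 < alpha < 2) (hn : (1 <= n)%N)
    (d : measure_display) (Omega : measurableType d)
    (P : Rn R n -> probability Omega R) (X : R -> Omega -> Rn R n)
    (hX : forall x, brownian_motion (P x) X x)
    (tau : R -> R)
    (htau : young_function tau)
    (htau2 : (tau y / y ^+ 2) @[y --> +oo] --> +oo)
    (htaup : forall p : R, 2 < p -> (tau y / y `^ p) @[y --> +oo] --> 0)
    (psi : R -> R)
    (htaupsi : forall y : R, 0 < y -> tau y = y ^+ 2 * psi y)
    (hpsi_pos : forall y : R, 0 < y -> 0 < psi y)
    (hpsi_ndecr : forall y z : R, 0 < y -> y <= z -> psi y <= psi z)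
    (hpsi_oo : psi y @[y --> +oo] --> +oo)
    (hpsi_doubling : exists k : R, forall y : R, 0 < y -> psi (2 * y) <= k * psi y)
    (hPexpU : exists t : R, 0 < t /\
       in_orlicz (nu_alpha n alpha) tau
         (P_alpha alpha P X t (fun x => expR (U_alpha n alpha x)))) :
  orlicz_hyperbounded (nu_alpha n alpha) tau (P_alpha alpha P X).
Proof.
have [t [t0 [mF tauF]]] := hPexpU.
have tt0 : 0 < t + t by rewrite addr_gt0.
have mLfun h : h \in Lfun (nu_alpha n alpha) 2%:E -> measurable_fun setT h.
  by rewrite inE => /andP[]; rewrite inE.
have [Z0|Z0] := boolP (0 < Z_alpha n alpha); last first.
  have nu0 := nu_alpha_degenerate (elimN idP Z0).
  exists t; split => //; split => [h hL2|h _ eps eps0].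
    split; first exact: (measurable_P_alpha halpha hX t0 (mLfun h hL2)).
    by rewrite nu0.
  exists 1; split => // g _ _; apply: (@le_lt_trans _ _ (eps / 2)%:E).
    apply: ereal_inf_lbound; exists (eps / 2) => //; split; first by lra.
    by rewrite nu0 lee_fin (young_ge0 htau htaupsi hpsi_pos).
  by rewrite lte_fin; lra.
have [K K0 domK] := P_alpha_dominated halpha hX t0 Z0.
pose W := fk_weight (v_alpha alpha) X.
(* P_t (e^U) = e^U E1, because the ground state cancels e^U *)
pose E1 x := fk_expect (v_alpha alpha) P X t (cst 1) x.
have cv : continuous (v_alpha alpha) by exact: continuous_v_alpha.
have vC y : v_alpha alpha y <= 4 by exact: v_alpha_le.
have E1_ge0 x : (0 <= E1 x)%E.
  by apply: integral_ge0 => w _; rewrite lee_fin mulr_ge0// fk_weight_ge0.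
have E1_fin x : E1 x \is a fin_num.
  by rewrite ge0_fin_numE//; exact: (fk_expect1_lty cv vC hX).
pose F x := fine (P_alpha alpha P X t (fun x => expR (U_alpha n alpha x)) x).
have FE x : P_alpha alpha P X t (fun x => expR (U_alpha n alpha x)) x = (F x)%:E.
  by rewrite /F fineK// P_alpha_expU fin_numM.
have FE1 x : ((F x)%:E = (expR (U_alpha n alpha x))%:E * E1 x)%E.
  by rewrite -FE P_alpha_expU.
have integrable_ground (h : Rn R n -> R) (N : R) x : measurable_fun setT h -> 0 < N ->
    (\int[nu_alpha n alpha]_y (h y ^+ 2)%:E <= (N ^+ 2)%:E)%E ->
    (P x).-integrable setT
      (fun w => (ground_transform alpha h (X (t + t) w) * W (t + t) w)%:E).
  move=> mh N0 hN; apply/integrableP; split.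
    apply/measurable_EFinP; apply: (measurable_fk_integrand cv hX) => //.
    exact: measurable_ground.
  apply: le_lt_trans (domK h N x mh N0 hN) _.
  by rewrite ltey_eq fin_numM.
apply: (hyperbounded_of_domination (S := P_alpha alpha P X) (F := F)
  htau htaupsi hpsi_pos hpsi_ndecr hpsi_doubling tt0 K0).
- exact: measurableT_comp mF.
- by move=> x; rewrite -lee_fin FE1 mule_ge0 ?lee_fin ?expR_ge0.
- by under eq_integral => x _ do rewrite -[(tau _)%:E]/(tau_ext tau (F x)%:E) -FE.
- by move=> h mh; exact: (measurable_P_alpha halpha hX tt0 mh).
- move=> h N x mh N0 hN; rewrite P_alphaE abseM EFinM FE1 gee0_abs ?lee_fin ?expR_ge0//.
  rewrite muleCA lee_wpmul2l ?lee_fin ?expR_ge0//.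
  apply: le_trans (domK h N x mh N0 hN).
  apply: le_abse_integral => //; apply/measurable_EFinP.
  apply: (measurable_fk_integrand cv hX) => //; exact: measurable_ground.
- move=> g h x gL2 hL2.
  have [Ng Ng0 gN] := Lfun2_sqr_bound gL2.
  have [Nh Nh0 hN] := Lfun2_sqr_bound hL2.
  have ig := integrable_ground g Ng x (mLfun g gL2) Ng0 gN.
  have ih := integrable_ground h Nh x (mLfun h hL2) Nh0 hN.
  rewrite !P_alphaE -muleBr//; last first.
    by apply: fin_num_adde_defr; exact: (integrable_fin_num measurableT ig).
  congr (_ * _)%E; rewrite /fk_expect -integralB//.
  apply: eq_integral => w _; rewrite -EFinB; congr (_%:E).
  by rewrite /ground_transform/=; ring.
Qed.
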